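(* Let $\mathfrak{D}$ be the Drinfeld double of $\mathfrak{B}(V)\#\Bbbk G$ and let $M(g,\varrho)$ be a simple $\mathfrak{D}(G)$-module. Then the Verma module $\mathsf{M}(g,\varrho)=\mathfrak{D}\otimes_{\mathfrak{D}^{\geq 0}}M(g,\varrho)$ has a unique maximal $\mathfrak{D}$-submodule, and this submodule is homogeneous with respect to the $\mathbb{Z}$-grading of $\mathsf{M}(g,\varrho)$.
   Context: Throughout, $\Bbbk$ is an algebraically closed field of characteristic zero, $G$ is a finite non-abelian group, and $V$ is a (left-left) Yetter–Drinfeld module over $\Bbbk G$ whose Nichols algebra $\mathfrak{B}(V)=\bigoplus_{n\ge 0}\mathfrak{B}^n(V)$ is finite-dimensional. Modules are left modules. For a finite-dimensional Hopf algebra $H$, the Drinfeld double is $H\otimes H^*$ as a coalgebra, with multiplication $(h\otimes f)(h'\otimes f')=\langle f_{(1)},h'_{(1)}\rangle\langle f_{(3)},\mathcal{S}(h'_{(3)})\rangle\,(hh'_{(2)}\otimes f'f_{(2)})$; it contains $H$ and $H^{*op}$ as Hopf subalgebras. $\mathfrak{D}(G)$ is the Drinfeld double of $\Bbbk G$, and $\mathfrak{D}$ is the Drinfeld double of the bosonization $\mathfrak{B}(V)\#\Bbbk G$. Let $\Bbbk^G=(\Bbbk G)^*$ with basis $\{\delta_h\}$ dual to $G$. Let $\overline V$ be $V^*$ with the Yetter–Drinfeld structure over $\Bbbk^G$ given by $\langle f\cdot y,x\rangle=\langle f,\mathcal{S}(x_{(-1)})\rangle\langle y,x_{(0)}\rangle$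 and $\langle y,g\cdot x\rangle=\langle y_{(-1)},g\rangle\langle y_{(0)},x\rangle$. One identifies $(\mathfrak{B}(V)\#\Bbbk G)^{*op}$ with $\mathfrak{B}(\overline V)\#\Bbbk^G$ (as graded Hopf algebras; $f\in\Bbbk^G$ acts as a functional on $\mathfrak{B}^0(V)\#\Bbbk G$ by $\langle f,g\rangle$ and vanishes in other degrees; $y\in\overline V$ acts by $x\#g\mapsto\langle y,x\rangle$ on $V\#\Bbbk G$ and vanishes in other degrees). Inside $\mathfrak{D}$, the subalgebra generated by $\Bbbk G$ and $\Bbbk^G$ is $\mathfrak{D}(G)$, multiplication gives a linear isomorphism $\mathfrak{B}(V)\otimes\mathfrak{D}(G)\otimes\mathfrak{B}(\overline V)\to\mathfrak{D}$, and $\mathfrak{D}$ is $\mathbb{Z}$-graded with $\deg V=-1$, $\deg\mathfrak{D}(G)=0$, $\deg\overline V=1$. $\mathfrak{D}^{\geq0}$ is the subalgebra generated by $\mathfrak{D}(G)$ and $\overline V$. Simple $\mathfrak{D}(G)$-modules: for $g\in G$ with centralizer $\mathcal{C}_g$ and an irreducible representation $(U,\varrho)$ of $\mathcal{C}_g$, $M(g,\varrho)=\Bbbk G\otimes_{\Bbbk\mathcal{C}_g}U$ with $f\cdot(x\otimes u)=\langle f,xgx^{-1}\rangle x\otimes u$ for $f\in\Bbbk^G$; every simple $\mathfrak{D}(G)$-module has this form. $M(g,\varrho)$ is a $\mathfrak{D}^{\geq 0}$-module with $\overline V$ acting by zero. The Verma module $\mathsf{M}(g,\varrho)=\mathfrak{D}\otimes_{\mathfrak{D}^{\geq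 0}}M(g,\varrho)$ equals $\mathfrak{B}(V)\otimes M(g,\varrho)$ as a $\mathfrak{D}(G)$-module and is a $\mathbb{Z}$-graded $\mathfrak{D}$-module with component of degree $n\le 0$ equal to $\mathsf{M}^n=\mathfrak{B}^{-n}(V)\otimes M(g,\varrho)$. *)

(* Defs.v *)
From HB Require Import structures.
From mathcomp Require Import all_boot all_order all_algebra all_fingroup.
From mathcomp Require Import all_solvable all_field all_character.

Set Implicit Arguments.
Unset Strict Implicit.
Unset Printing Implicit Defensive.

Import GRing.Theory.
Local Open Scope ring_scope.

(** * Tensor products of finite-dimensional vector spaces

    [tensor U W] is represented by coefficient matrices with respect to the
    bases [vbasis {:U}] and [vbasis {:W}]: the matrix [t] stands for
    [\sum_i \sum_j t i j (e_i (x) e_j)].  For a bilinear [f], [tlift f] is the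
    linear map induced by [f]; when [t] is a coproduct [Delta x],
    [tlift f t] is what Sweedler's notation writes [f (x_(1), x_(2))]. *)

Section Tensor.
Variable k : fieldType.
Implicit Types U W Y Z : vectType k.

Definition tensor U W : vectType k := 'M[k]_(\dim {:U}, \dim {:W}).

Definition tens U W (u : U) (w : W) : tensor U W :=
  \matrix_(i, j) (coord (vbasis {:U}) i u * coord (vbasis {:W}) j w).

Definition tlift U W Z (f : U -> W -> Z) (t : tensor U W) : Z :=
  \sum_i \sum_j
    (t : 'M[k]_(\dim {:U}, \dim {:W})) i j
      *: f (vbasis {:U})`_i (vbasis {:W})`_j.

Definition tlift3 U W Y Z (f : U -> W -> Y -> Z)
    (t : tensor U (tensor W Y)) : Z :=
  tlift (fun u => tlift (f u)) t.

Definition tensv U W (X : {vspace U}) (Y : {vspace W}) :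
    {vspace tensor U W} :=
  <<[seq tens u w | u <- vbasis X, w <- vbasis Y]>>%VS.

End Tensor.

Notation "u ⊗ w" := (tens u w) (at level 38, right associativity).

(** * Induced modules

    [A] is an algebra with multiplication [mul], [S] (the span of) a
    subalgebra, and [act] an action on [M] of which only the restriction to [S]
    is used.  [induced mul S act] is [A (x)_S M], the quotient of [A (x) M] by
    [balanced_rel]; a quotient [E / W] is realised on the complement [W^C],
    with projection [E -> W^C] along [W]. *)

Section Induced.
Variables (k : fieldType) (A M : vectType k).
Variables (mul : A -> A -> A) (S : {vspace A}) (act : A -> M -> M).

Definition balanced_rel : {vspace tensor A M} :=
  <<[seq mul p.1 p.2 ⊗ m - p.1 ⊗ act p.2 m
      | p <- [seq (a, s) | a <- vbasis {:A}, s <- vbasis S],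
        m <- vbasis {:M}]>>%VS.

Definition induced : vectType k := subvs_of (balanced_rel^C)%VS.

Definition ind_proj (t : tensor A M) : induced :=
  vsproj (balanced_rel^C)%VS (daddv_pi (balanced_rel^C)%VS balanced_rel t).

Definition ind_lift (Z : vectType k) (f : A -> M -> Z) (w : induced) : Z :=
  tlift f (vsval w).

Definition ind_act (a : A) (w : induced) : induced :=
  ind_lift (fun b m => ind_proj (mul a b ⊗ m)) w.

End Induced.

(** * Hopf algebras, duals and Drinfeld doubles

    [hopfOps] records only the structure maps of a finite-dimensional Hopf
    algebra; it is instantiated below at group algebras and at bosonizations,
    for which the Hopf algebra axioms are theorems. *)

Record hopfOps (k : fieldType) := HopfOps {
  ho_car :> vectType k;
  ho_mul : ho_car -> ho_car -> ho_car;
  ho_one : ho_car;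
  ho_comul : ho_car -> tensor ho_car ho_car;
  ho_counit : ho_car -> k;
  ho_anti : ho_car -> ho_car }.

Section Double.
Variables (k : fieldType) (H : hopfOps k).

Definition hdual : vectType k := 'Hom(H, k^o).
Implicit Types (f : hdual) (h : H).

Definition comul3 h : tensor H (tensor H H) :=
  tlift (fun a b => a ⊗ ho_comul b) (ho_comul h).

Definition dual_mul f f' : hdual :=
  linfun (fun x : H => tlift (fun a b => f a * f' b : k^o) (ho_comul x)).

Definition dual_one : hdual := linfun (fun x : H => ho_counit x : k^o).

(* [f_(1) (x) f_(2)], determined by [f (x y) = f_(1) x * f_(2) y]. *)
Definition dual_comul f : tensor hdual hdual :=
  \sum_(i < \dim {:H})
    (linfun (fun x : H => coord (vbasis {:H}) i x : k^o) : hdual)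
      ⊗ (linfun (fun y : H => f (ho_mul (vbasis {:H})`_i y)) : hdual).

Definition dual_comul3 f : tensor hdual (tensor hdual hdual) :=
  tlift (fun a b => a ⊗ dual_comul b) (dual_comul f).

Definition drinfeld : vectType k := tensor H hdual.

(* [(h (x) f) (h' (x) f')
      = <f_(1), h'_(1)> <f_(3), S h'_(3)> (h h'_(2) (x) f' f_(2))] *)
Definition double_mul (s t : drinfeld) : drinfeld :=
  tlift (fun h f => tlift (fun h' f' =>
    tlift3 (fun f1 f2 f3 => tlift3 (fun h1 h2 h3 =>
      (f1 h1 * f3 (ho_anti h3) : k) *: (ho_mul h h2 ⊗ dual_mul f' f2))
    (comul3 h')) (dual_comul3 f)) t) s.

Definition double_one : drinfeld := ho_one H ⊗ dual_one.

(* The subalgebra of the double generated by [X]: as in [agenv], powers below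
   the dimension suffice. *)
Definition double_prodv (X Y : {vspace drinfeld}) : {vspace drinfeld} :=
  <<[seq double_mul x y | x <- vbasis X, y <- vbasis Y]>>%VS.

Definition double_gen (X : {vspace drinfeld}) : {vspace drinfeld} :=
  (\sum_(i < \dim {:drinfeld})
     iter i (double_prodv X) <[double_one]>)%VS.

End Double.

(** * Group algebras *)

Section GroupAlgebra.
Variables (k : fieldType) (gT : finGroupType).

Definition grpalg : vectType k := {ffun gT -> k^o}.

Definition gelt (g : gT) : grpalg := [ffun x => (x == g)%:R].

Definition glift (Z : lmodType k) (f : gT -> Z) (a : grpalg) : Z :=
  \sum_g (a g : k) *: f g.

Definition groupHopf : hopfOps k :=
  @HopfOps k grpalg
    (fun a b => glift (fun g => glift (fun h => gelt (g * h)%g) b) a)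
    (gelt 1%g)
    (glift (fun g => gelt g ⊗ gelt g))
    (fun a => glift (fun _ => 1 : k^o) a)
    (glift (fun g => gelt g^-1%g)).

Definition subgrpalg (C : {set gT}) : {vspace grpalg} :=
  <<[seq gelt c | c <- enum C]>>%VS.

End GroupAlgebra.

Arguments gelt {k gT} g.

(** * Yetter-Drinfeld modules over a group algebra

    The coaction [V -> kG (x) V], [x |-> x_(-1) (x) x_(0)], is given by its
    components along the basis [G] of [kG]:
    [x_(-1) (x) x_(0) = \sum_g g (x) yd_coact g x]. *)

Record ydStruct (k : fieldType) (gT : finGroupType) (V : vectType k) := YD {
  yd_act : gT -> 'End(V);
  yd_coact : gT -> 'End(V);
  yd_act1 : forall x, yd_act 1%g x = x;
  yd_actM : forall g h x, yd_act (g * h)%g x = yd_act g (yd_act h x);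
  yd_coassoc : forall g h x,
    yd_coact h (yd_coact g x) = if h == g then yd_coact g x else 0;
  yd_counit : forall x, \sum_g yd_coact g x = x;
  yd_compat : forall g h x,
    yd_coact (h * g * h^-1)%g (yd_act h x) = yd_act h (yd_coact g x) }.

(** * Hopf algebras in the category of Yetter-Drinfeld modules *)

Section BraidedHopf.
Variables (k : fieldType) (gT : finGroupType).

Record braidedHopf := BraidedHopf {
  bh_alg :> falgType k;
  bh_yd : ydStruct gT bh_alg;
  bh_comul : 'Hom(bh_alg, tensor bh_alg bh_alg);
  bh_counit : 'Hom(bh_alg, k^o);
  bh_anti : 'End(bh_alg);

  bh_coassoc : forall x,
    tlift (fun a b => tlift (fun c d => c ⊗ d ⊗ b) (bh_comul a)) (bh_comul x)
    = tlift (fun a b => a ⊗ bh_comul b) (bh_comul x);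
  bh_counitl : forall x,
    tlift (fun a b => (bh_counit a : k) *: b) (bh_comul x) = x;
  bh_counitr : forall x,
    tlift (fun a b => (bh_counit b : k) *: a) (bh_comul x) = x;

  (* The coproduct is multiplicative for the braided product
     [(a (x) b) (c (x) d) = a (b_(-1) . c) (x) b_(0) d]. *)
  bh_comul1 : bh_comul 1 = 1 ⊗ 1;
  bh_comulM : forall x y,
    bh_comul (x * y) =
    tlift (fun a b => tlift (fun c d =>
      \sum_h (a * yd_act bh_yd h c) ⊗ (yd_coact bh_yd h b * d))
      (bh_comul y)) (bh_comul x);
  bh_counit1 : bh_counit 1 = 1;
  bh_counitM : forall x y,
    bh_counit (x * y) = bh_counit x * bh_counit y :> k;
  bh_antil : forall x,
    tlift (fun a b => bh_anti a * b) (bh_comul x) = (bh_counit x : k) *: 1;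
  bh_antir : forall x,
    tlift (fun a b => a * bh_anti b) (bh_comul x) = (bh_counit x : k) *: 1;

  (* All structure maps are morphisms of Yetter-Drinfeld modules. *)
  bh_act1 : forall g, yd_act bh_yd g 1 = 1;
  bh_actM : forall g x y,
    yd_act bh_yd g (x * y) = yd_act bh_yd g x * yd_act bh_yd g y;
  bh_coact1 : forall g, yd_coact bh_yd g 1 = if g == 1%g then 1 else 0;
  bh_coactM : forall g x y,
    yd_coact bh_yd g (x * y) =
    \sum_h yd_coact bh_yd h x * yd_coact bh_yd (h^-1 * g)%g y;
  bh_comul_act : forall g x,
    bh_comul (yd_act bh_yd g x) =
    tlift (fun a b => yd_act bh_yd g a ⊗ yd_act bh_yd g b) (bh_comul x);
  bh_comul_coact : forall g x,
    bh_comul (yd_coact bh_yd g x) =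
    tlift (fun a b =>
      \sum_h yd_coact bh_yd h a ⊗ yd_coact bh_yd (h^-1 * g)%g b) (bh_comul x);
  bh_counit_act : forall g x, bh_counit (yd_act bh_yd g x) = bh_counit x;
  bh_counit_coact : forall g x,
    bh_counit (yd_coact bh_yd g x) = if g == 1%g then bh_counit x else 0;
  bh_anti_act : forall g x,
    bh_anti (yd_act bh_yd g x) = yd_act bh_yd g (bh_anti x);
  bh_anti_coact : forall g x,
    bh_anti (yd_coact bh_yd g x) = yd_coact bh_yd g (bh_anti x) }.

(** ** Nichols algebras

    A Nichols algebra of [V] is a graded Hopf algebra [R] in Yetter-Drinfeld
    modules with [R^0 = k], [R^1] isomorphic to [V], generated by [R^1], whose
    space of primitive elements is [R^1]; these conditions determine it up to
    isomorphism.  It is finite-dimensional here, as a [falgType].  The grading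
    is given by the maps [na_comp n] sending an element to its homogeneous
    component of degree [n]. *)

Record nicholsAlgebra (V : vectType k) (ydV : ydStruct gT V) := Nichols {
  na_hopf :> braidedHopf;
  na_comp : nat -> 'End(na_hopf);
  na_emb : 'Hom(V, na_hopf);
  na_gr := fun n => limg (na_comp n);

  na_comp_ortho : forall m n x,
    na_comp m (na_comp n x) = if m == n then na_comp n x else 0;
  na_comp_sum : exists b, forall x, \sum_(n < b) na_comp n x = x;

  na_gr_act : forall n g x,
    x \in na_gr n -> yd_act (bh_yd na_hopf) g x \in na_gr n;
  na_gr_coact : forall n g x,
    x \in na_gr n -> yd_coact (bh_yd na_hopf) g x \in na_gr n;
  na_gr_mul : forall m n x y,
    x \in na_gr m -> y \in na_gr n -> x * y \in na_gr (m + n);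
  na_gr_comul : forall n x, x \in na_gr n ->
    bh_comul na_hopf x \in (\sum_(i < n.+1) tensv (na_gr i) (na_gr (n - i)))%VS;
  na_gr_counit : forall n x,
    x \in na_gr n -> (0 < n)%N -> bh_counit na_hopf x = 0;
  na_gr_anti : forall n x, x \in na_gr n -> bh_anti na_hopf x \in na_gr n;

  na_gr0 : na_gr 0 = <[1]>%VS;
  na_emb_inj : lker na_emb = 0%VS;
  na_emb_img : limg na_emb = na_gr 1;
  na_emb_act : forall g v,
    na_emb (yd_act ydV g v) = yd_act (bh_yd na_hopf) g (na_emb v);
  na_emb_coact : forall g v,
    na_emb (yd_coact ydV g v) = yd_coact (bh_yd na_hopf) g (na_emb v);
  na_prim : forall x,
    bh_comul na_hopf x = x ⊗ 1 + 1 ⊗ x <-> x \in na_gr 1;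
  na_gen : agenv (na_gr 1) = fullv }.

End BraidedHopf.

(** * Bosonization

    [boson R] is [R # kG]; [x # g] is [x ⊗ gelt g]. *)

Section Bosonization.
Variables (k : fieldType) (gT : finGroupType) (R : braidedHopf k gT).
Local Notation kG := (grpalg k gT).
Local Notation act := (yd_act (bh_yd R)).
Local Notation coact := (yd_coact (bh_yd R)).
Local Notation "x # g" := (tens x (gelt g : grpalg k gT)) (at level 39).

Definition blift (Z : vectType k) (f : R -> gT -> Z) (a : tensor R kG) : Z :=
  tlift (fun x c => glift (f x) c) a.

(* [(x # g) (y # h) = x (g . y) # g h] *)
Definition boson_mul (a b : tensor R kG) : tensor R kG :=
  blift (fun x g => blift (fun y h => (x * act g y) # (g * h)%g) b) a.

(* [Delta (x # g) = (x^(1) # (x^(2))_(-1) g) (x) ((x^(2))_(0) # g)] *)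
Definition boson_comul (a : tensor R kG) :
    tensor (tensor R kG) (tensor R kG) :=
  blift (fun x g =>
    tlift (fun y z => \sum_h (y # (h * g)%g) ⊗ (coact h z # g))
      (bh_comul R x)) a.

(* [S (x # g) = (1 # (x_(-1) g)^-1) (S_R (x_(0)) # 1)] *)
Definition boson_anti (a : tensor R kG) : tensor R kG :=
  blift (fun x g =>
    \sum_h boson_mul (1 # (h * g)^-1%g) (bh_anti R (coact h x) # 1%g)) a.

Definition boson : hopfOps k :=
  @HopfOps k (tensor R kG) boson_mul (1 # 1%g) boson_comul
    (fun a => blift (fun x _ => bh_counit R x) a) boson_anti.

(* The projection onto degree 0, [x # g |-> epsilon (x) g], and the inclusion
   of [kG] in degree 0. *)
Definition boson_proj (a : boson) : grpalg k gT :=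
  blift (fun x g => (bh_counit R x : k) *: gelt g) a.

Definition boson_incl (c : grpalg k gT) : boson := (1 : R) ⊗ c.

(* The resulting linear map from the double of [R # kG] to the double of [kG]. *)
Definition double_proj (d : drinfeld boson) : drinfeld (groupHopf k gT) :=
  tlift (fun a (f : hdual boson) =>
    boson_proj a ⊗
      (linfun (fun c : grpalg k gT => f (boson_incl c)) : hdual (groupHopf k gT))) d.

End Bosonization.

(** * The simple modules [M(g, rho)] over the double of [kG] *)

Section SimpleModules.
Variables (k : fieldType) (gT : finGroupType) (g : gT) (n : nat).
Variable rho : mx_representation k 'C[g]%g n.
Local Notation kG := (groupHopf k gT).

(* [rho] acts on the left on column vectors; only the values on the
   centralizer matter. *)
Definition cent_act (c : grpalg k gT) (u : 'cV[k]_n) : 'cV[k]_n :=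
  \sum_(x in 'C[g]%g) (c x : k) *: (rho x *m u).

Definition simpleDG : vectType k :=
  induced (@ho_mul k kG) (subgrpalg k 'C[g]%g) cent_act.

(* [f . (x (x) u) = <f, x g x^-1> x (x) u] *)
Definition simpleDG_fun (f : hdual kG) (m : simpleDG) : simpleDG :=
  ind_lift (fun a u => ind_proj (@ho_mul k kG) (subgrpalg k 'C[g]%g) cent_act
    (glift (fun x => (f (gelt (x * g * x^-1)%g) : k) *: gelt x) a ⊗ u)) m.

Definition simpleDG_act (d : drinfeld kG) (m : simpleDG) : simpleDG :=
  tlift (fun (a : kG) f => ind_act a (simpleDG_fun f m)) d.

End SimpleModules.

(** * The double of [B(V) # kG] and its Verma modules *)

Section Verma.
Variables (k : fieldType) (gT : finGroupType).
Variables (V : vectType k) (ydV : ydStruct gT V) (B : nicholsAlgebra ydV).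
Local Notation A := (boson B).
Local Notation D := (drinfeld (boson B)).

(* [f] in [k^G] and [y] in [V^*] as functionals on [B(V) # kG]: [f] is
   supported in degree 0, and [y] sends [x # h] to [<y, x>] for [x] in [V] and
   vanishes in the other degrees. *)
Definition fun_of_kG (f : hdual (groupHopf k gT)) : hdual A :=
  linfun (fun a : A => f (boson_proj a)).

Definition fun_of_dualV (y : 'Hom(V, k^o)) : hdual A :=
  linfun (fun a : A => blift (fun x _ => y ((na_emb B)^-1%VF (na_comp B 1 x))) a).

Definition Dgroup : {vspace D} :=
  <<[seq boson_incl B (gelt h) ⊗ dual_one A | h <- enum gT]>>%VS.

Definition Dfun : {vspace D} :=
  <<[seq ho_one A ⊗ fun_of_kG f | f <- vbasis {:hdual (groupHopf k gT)}]>>%VS.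

Definition Dbar : {vspace D} :=
  <<[seq ho_one A ⊗ fun_of_dualV y | y <- vbasis {:'Hom(V, k^o)}]>>%VS.

Definition Dge0 : {vspace D} := double_gen (Dgroup + Dfun + Dbar)%VS.

Variables (g : gT) (n : nat) (rho : mx_representation k 'C[g]%g n).

(* [M(g, rho)] as a module over [Dge0], with [V^*] acting by zero: [double_proj]
   restricts to an algebra map from [Dge0] onto the double of [kG] which is the
   identity on [kG] and [k^G] and kills [V^*]. *)
Definition Dge0_act (d : D) (m : simpleDG rho) : simpleDG rho :=
  simpleDG_act (double_proj d) m.

Definition verma : vectType k := induced (@double_mul k A) Dge0 Dge0_act.

Definition verma_act (d : D) (w : verma) : verma := ind_act d w.

(* The component of degree [i]: the image of [B^(-i)(V) (x) M(g, rho)] when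
   [i <= 0]. *)
Definition verma_gr (i : int) : {vspace verma} :=
  if i <= 0 then
    <<[seq ind_proj (@double_mul k A) Dge0 Dge0_act
             (((x ⊗ gelt 1%g : A) ⊗ dual_one A) ⊗ m)
        | x <- vbasis (na_gr B `|i|%N), m <- vbasis {:simpleDG rho}]>>%VS
  else 0%VS.

Definition submodule (N : {vspace verma}) : Prop :=
  forall d w, w \in N -> verma_act d w \in N.

Definition maximal_submodule (N : {vspace verma}) : Prop :=
  [/\ submodule N, N <> fullv
    & forall N', submodule N' -> (N <= N')%VS -> N' = N \/ N' = fullv].

Definition homogeneous (N : {vspace verma}) : Prop :=
  forall w, w \in N ->
    exists s : seq int, w \in (\sum_(i <- s) (N :&: verma_gr i))%VS.

End Verma.

(* Main.v *)
Require Import Defs.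
From HB Require Import structures.
From Stdlib Require Import Classical.
From mathcomp Require Import all_boot all_order all_algebra all_fingroup.
From mathcomp Require Import all_solvable all_field all_character.
Import GRing.Theory.
Local Open Scope ring_scope.

(* Triangular decomposition identifies the Verma module with B(V) (x) M, where
   M = M(g, rho) sits in degree 0.  Let N be a submodule containing some y with
   nonzero component in degree 0.  The degree 0 components of elements of N form
   a D(G)-submodule of the simple module M, hence all of M: for every m there is
   an element 1 (x) m + (lower terms) in N.  Acting on it by x in B(V) gives
   x (x) m + (lower terms), and induction from the lowest degree upwards shows
   that N is everything.  So proper submodules live in negative degrees, the
   largest submodule contained in negative degrees is the unique maximal one, and
   it contains all homogeneous components of its elements because these also span
   a submodule in negative degrees.

   The identification with B(V) (x) M needs that the subalgebra generated by kG,
   k^G and V^* contains the whole dual of B(V) # kG; this is dual to the fact that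
   all primitive elements of B(V) have degree 1. *)

Set Implicit Arguments.
Unset Strict Implicit.
Unset Printing Implicit Defensive.

(** * Linear maps *)

(** Submodules are subspaces stable under the operators [verma_act d], so what matters is the effect
    of these operators on the tensors [x ⊗ m]. Computing it in the quotient takes associativity of
    the double with right factor in [Dge0], and this is checked on the generators of [Dge0], where
    the product formula collapses. The identification with B(V) (x) M is a pair of inverse maps.
    [Theta] goes out of the quotient and has to respect the relations over [Dge0], again a check on
    generators. [vgen] goes back, and it reaches everything only if each [(1 # h) ⊗ f] lies in
    [Dge0]: this is where generation of the dual enters. The homogeneous components of a stable
    subspace span a stable subspace because the double is spanned by elements that shift the degree
    by a fixed amount. *)

Definition lin (k : fieldType) (U W : lmodType k) (f : U -> W) :=
  forall a u v, f (a *: u + v) = a *: f u + f v.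

Section LinBasics.
Variables (k : fieldType) (U W : lmodType k) (f : U -> W).
Hypothesis fL : lin f.

Lemma lin0 : f 0 = 0.
Proof. by have := fL (-1) 0 0; rewrite scaler0 addr0 scaleN1r addNr. Qed.

Lemma linD : {morph f : u v / u + v}.
Proof. by move=> u v; rewrite -{1}[u]scale1r fL scale1r. Qed.

Lemma linZ a u : f (a *: u) = a *: f u.
Proof. by rewrite -[a *: u]addr0 fL lin0 addr0. Qed.

Lemma linB : {morph f : u v / u - v}.
Proof. by move=> u v; rewrite linD -scaleN1r linZ scaleN1r. Qed.

Lemma lin_bigsum (I : Type) (r : seq I) (P : pred I) F :
  f (\sum_(i <- r | P i) F i) = \sum_(i <- r | P i) f (F i).
Proof. exact: (big_morph f linD lin0). Qed.

(** The vacuous [let] makes the constant depend on [fL], so that the linear structure declared next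
    keeps its proof of linearity when the section closes. *)
Definition lin_fun := let _ := fL in f.
HB.instance Definition _ := GRing.isLinear.Build k U W *:%R lin_fun fL.
Definition lin_linear : {linear U -> W} := lin_fun.
End LinBasics.

Lemma linfunE (k : fieldType) (U W : vectType k) (f : U -> W) :
  lin f -> linfun f =1 f.
Proof. by move=> fL x; exact: (lfunE (lin_linear fL) x). Qed.

Section LinClosure.
Variable k : fieldType.

Lemma lin_id (U : lmodType k) : lin (fun x : U => x).
Proof. by []. Qed.

Lemma lin_comp (U W Z : lmodType k) (h : W -> Z) (f : U -> W) :
  lin h -> lin f -> lin (fun x => h (f x)).
Proof. by move=> hL fL a u v; rewrite fL hL. Qed.

Lemma lin_cst0 (U W : lmodType k) : lin (fun _ : U => 0 : W).
Proof. by move=> a u v; rewrite scaler0 addr0. Qed.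

Lemma lin_linear_fun (U W : lmodType k) (h : {linear U -> W}) : lin h.
Proof. by move=> a u v; rewrite linearP. Qed.

Lemma lin_lfun (U : lmodType k) (W Z : vectType k) (h : 'Hom(W, Z)) (f : U -> W) :
  lin f -> lin (fun x => h (f x)).
Proof. by move=> fL a u v; rewrite fL linearP. Qed.

Lemma lin_add (U W : lmodType k) (f g : U -> W) :
  lin f -> lin g -> lin (fun x => f x + g x).
Proof. by move=> fL gL a u v; rewrite fL gL scalerDr addrACA. Qed.

Lemma lin_sub (U W : lmodType k) (f g : U -> W) :
  lin f -> lin g -> lin (fun x => f x - g x).
Proof. by move=> fL gL a u v; rewrite fL gL scalerBr opprD addrACA. Qed.

Lemma lin_sum (U W : lmodType k) (I : Type) (r : seq I) (P : pred I)
    (f : I -> U -> W) :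
  (forall i, lin (f i)) -> lin (fun x => \sum_(i <- r | P i) f i x).
Proof.
move=> fL a u v; rewrite scaler_sumr -big_split /=.
by apply: eq_bigr => i _; rewrite fL.
Qed.

Lemma lin_scaler (U W : lmodType k) (c : k) (f : U -> W) :
  lin f -> lin (fun x => c *: f x).
Proof. by move=> fL a u v; rewrite fL scalerDr !scalerA mulrC. Qed.

Lemma lin_scalel (U W : lmodType k) (f : U -> k^o) (w : W) :
  lin f -> lin (fun x => (f x : k) *: w).
Proof. by move=> fL a u v; rewrite fL scalerDl -scalerA. Qed.

Lemma lin_mulk (U : lmodType k) (f : U -> k^o) (c : k) :
  lin f -> lin (fun x => (f x : k) * c : k^o).
Proof. by move=> fL a u v; rewrite fL mulrDl -mulrA. Qed.

Lemma lin_kmul (U : lmodType k) (f : U -> k^o) (c : k) :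
  lin f -> lin (fun x => c * (f x : k) : k^o).
Proof. by move=> fL a u v; rewrite fL mulrDr mulrCA. Qed.

Lemma lin_mull (U : lmodType k) (A : falgType k) (f : U -> A) c :
  lin f -> lin (fun x => f x * c).
Proof. by move=> fL a u v; rewrite fL mulrDl scalerAl. Qed.

Lemma lin_mulr (U : lmodType k) (A : falgType k) (f : U -> A) c :
  lin f -> lin (fun x => c * f x).
Proof. by move=> fL a u v; rewrite fL mulrDr scalerAr. Qed.

Lemma lin_if (U W : lmodType k) (b : bool) (f g : U -> W) :
  lin f -> lin g -> lin (fun x => if b then f x else g x).
Proof. by case: b. Qed.

Lemma lin_linfun (X : lmodType k) (U W : vectType k) (f : X -> U -> W) :
  (forall x, lin (f x)) -> (forall u, lin (f^~ u)) ->
  lin (fun x => linfun (f x)).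
Proof.
move=> fL fL' a x y; apply/lfunP => u.
by rewrite add_lfunE scale_lfunE !linfunE //; exact: fL'.
Qed.

Lemma lin_lfunl (X : lmodType k) (U W : vectType k) (f : X -> 'Hom(U, W)) u :
  lin f -> lin (fun x => f x u).
Proof. by move=> fL a x y; rewrite fL add_lfunE scale_lfunE. Qed.

End LinClosure.

(** * Tensor products *)

Section TensorTheory.
Variable k : fieldType.
Implicit Types U W Y Z : vectType k.

Lemma lin_tensl (X : lmodType k) U W (f : X -> U) (w : W) :
  lin f -> lin (fun x => f x ⊗ w).
Proof.
by move=> fL a u v; apply/matrixP => i j; rewrite !mxE fL linearP mulrDl -mulrA.
Qed.

Lemma lin_tensr (X : lmodType k) U W (u : U) (f : X -> W) :
  lin f -> lin (fun x => u ⊗ f x).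
Proof.
move=> fL a x y; apply/matrixP => i j.
by rewrite !mxE fL linearP mulrDr mulrCA.
Qed.

Lemma lin_tlift (X : lmodType k) U W Z (F : U -> W -> Z) (t : X -> tensor U W) :
  lin t -> lin (fun x => tlift F (t x)).
Proof.
move=> tL; rewrite /tlift; do 2!apply: lin_sum => ?.
by apply: lin_scalel => a x y; rewrite tL !mxE.
Qed.

Lemma lin_tlift_fun (X : lmodType k) U W Z (F : X -> U -> W -> Z) (t : tensor U W) :
  (forall u w, lin (fun x => F x u w)) -> lin (fun x => tlift (F x) t).
Proof.
by move=> FL; rewrite /tlift; do 2!apply: lin_sum => ?; apply: lin_scaler.
Qed.

Definition bilin U W (Z : lmodType k) (f : U -> W -> Z) :=
  (forall u, lin (f u)) /\ (forall w, lin (f^~ w)).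

Lemma coord_vbasis_sum U (u : U) :
  u = \sum_i coord (vbasis {:U}) i u *: (vbasis {:U})`_i.
Proof. exact/coord_vbasis/memvf. Qed.

Lemma tlift_tens U W Z (f : U -> W -> Z) u w :
  bilin f -> tlift f (u ⊗ w) = f u w.
Proof.
move=> [fr fl]; rewrite [in RHS](coord_vbasis_sum u) (lin_bigsum (fl w)).
apply: eq_bigr => i _; rewrite (linZ (fl w)).
rewrite [in RHS](coord_vbasis_sum w) (lin_bigsum (fr _)) scaler_sumr.
by apply: eq_bigr => j _; rewrite (linZ (fr _)) mxE scalerA.
Qed.

Lemma tensor_sum U W (t : tensor U W) :
  t = \sum_i \sum_j (t : 'M[k]_(\dim {:U}, \dim {:W})) i j
        *: ((vbasis {:U})`_i ⊗ (vbasis {:W})`_j).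
Proof.
pose ent i j (t : tensor U W) : k^o :=
  (t : 'M[k]_(\dim {:U}, \dim {:W})) i j.
have eL i j : lin (ent i j) by move=> a x y; rewrite /ent !mxE.
have cf (X : vectType k) (i j : 'I_(\dim {:X})) :
    coord (vbasis {:X}) j (vbasis {:X})`_i = (j == i)%:R.
  by rewrite coord_free 1?eq_sym //; exact: basis_free (vbasisP _).
have entE i j (i' : 'I_(\dim {:U})) (j' : 'I_(\dim {:W})) : ent i j ((vbasis {:U})`_i' ⊗ (vbasis {:W})`_j')
    = ((i == i')%:R * (j == j')%:R : k) by rewrite /ent mxE !cf.
apply/matrixP => i j; rewrite -[RHS]/(ent i j (\sum_i0 \sum_j0 _)).
rewrite (lin_bigsum (eL i j)) (bigD1 i) //=.
rewrite [X in _ + X]big1 ?addr0 => [|i' ne]; rewrite (lin_bigsum (eL i j)).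
  rewrite (bigD1 j) //= big1 ?addr0 => [|j' ne]; rewrite (linZ (eL i j)) entE.
    by rewrite !eqxx mulr1; exact/esym/mulr1.
  by rewrite [j == _]eq_sym (negbTE ne) mulr0 scaler0.
rewrite big1 // => j' _; rewrite (linZ (eL i j)) entE.
by rewrite [i == _]eq_sym (negbTE ne) mul0r scaler0.
Qed.

Lemma tens_ind U W (P : tensor U W -> Prop) :
  (forall a s t, P s -> P t -> P (a *: s + t)) -> (P 0) ->
  (forall u w, P (u ⊗ w)) -> forall t, P t.
Proof.
move=> PL P0 Pt t; rewrite [t]tensor_sum.
have PD s s' : P s -> P s' -> P (s + s').
  by move=> Ps Ps'; rewrite -[s]scale1r; exact: PL.
apply: (big_ind P) => // i _; apply: (big_ind P) => // j _.
by rewrite -[_ *: _]addr0; exact: PL.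
Qed.

Lemma tens_ext U W (Z : lmodType k) (f g : tensor U W -> Z) :
  lin f -> lin g -> (forall u w, f (u ⊗ w) = g (u ⊗ w)) -> f =1 g.
Proof.
move=> fL gL fg; apply: tens_ind => [a s t fs ft||//].
  by rewrite fL gL fs ft.
by rewrite (lin0 fL) (lin0 gL).
Qed.

Lemma eq_tlift U W Z (f g : U -> W -> Z) t :
  (forall u w, f u w = g u w) -> tlift f t = tlift g t.
Proof. by move=> fg; rewrite /tlift; do 2!apply: eq_bigr => ? _; rewrite fg. Qed.

Lemma lin_tlift_comp U W Y Z (h : Y -> Z) (f : U -> W -> Y) t :
  lin h -> h (tlift f t) = tlift (fun u w => h (f u w)) t.
Proof.
move=> hL; rewrite /tlift (lin_bigsum hL); apply: eq_bigr => i _.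
by rewrite (lin_bigsum hL); apply: eq_bigr => j _; rewrite linZ.
Qed.

Lemma tlift_sum U W Z I (r : seq I) (P : pred I) (F : I -> U -> W -> Z) t :
  tlift (fun u w => \sum_(i <- r | P i) F i u w) t
    = \sum_(i <- r | P i) tlift (F i) t.
Proof.
rewrite /tlift; under eq_bigr do under eq_bigr do rewrite scaler_sumr.
by under eq_bigr do rewrite exchange_big /=; rewrite exchange_big.
Qed.

Lemma memv_tens U W (X : {vspace U}) (Y : {vspace W}) u w :
  u \in X -> w \in Y -> u ⊗ w \in tensv X Y.
Proof.
move=> uX wY; rewrite (coord_vbasis uX) (coord_vbasis wY).
rewrite (lin_bigsum (lin_tensl _ (@lin_id _ _))) memv_suml // => i _.
rewrite (linZ (lin_tensl _ (@lin_id _ _))) memvZ //.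
rewrite (lin_bigsum (lin_tensr _ (@lin_id _ _))) memv_suml // => j _.
rewrite (linZ (lin_tensr _ (@lin_id _ _))) memvZ //.
apply/memv_span/allpairsP; exists ((vbasis X)`_i, (vbasis Y)`_j).
by split; rewrite ?mem_nth ?size_tuple.
Qed.

Lemma tensv_lin_mem U W Z (X : {vspace U}) (Y : {vspace W}) (f : tensor U W -> Z)
    (T : {vspace Z}) :
  lin f -> (forall u w, u \in X -> w \in Y -> f (u ⊗ w) \in T) ->
  forall t, t \in tensv X Y -> f t \in T.
Proof.
move=> fL fT t tXY.
have fE := linfunE fL; rewrite -fE memv_preim.
move: tXY; apply/subvP/span_subvP => _ /allpairsP[[u w] [uX wY ->]].
by rewrite -memv_preim fE fT //; exact: vbasis_mem.
Qed.

End TensorTheory.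

Arguments lin_id {k U}.

(** A hook, redefined with [::=] further on to teach [lin_tac] the linearity of the Hopf
    operations. *)
Ltac lin_ext := fail.

Ltac lin_step :=
  lazymatch goal with
  | |- bilin _ => split => ? /=
  | |- lin (fun x => x) => exact: lin_id
  | |- lin (fun x => 0) => exact: lin_cst0
  | |- lin (fun x => tens _ _) => first [apply: lin_tensl | apply: lin_tensr]
  | |- lin (tens ?w) => apply: (lin_tensr w lin_id)
  | |- lin (fun x => tlift _ _) => first [apply: lin_tlift | apply: lin_tlift_fun => ? ? /=]
  | |- lin (tlift _) => apply: lin_tlift; exact: lin_id
  | |- lin (fun x => bigop _ _ _) => apply: lin_sum => ? /=
  | |- lin (fun x => (@?f x) + - (@?g x)) => apply: (lin_sub (f := f) (g := g))
  | |- lin (fun x => (@?f x) + (@?g x)) => apply: (lin_add (f := f) (g := g))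
  | |- lin (fun x => if _ then _ else _) => apply: lin_if
  | |- lin (fun x => fun_of_lfun _ _) => first [apply: lin_lfun | apply: lin_lfunl]
  | |- lin (fun_of_lfun ?h) => apply: (lin_lfun h lin_id)
  | |- lin (fun x => linfun (@?f x)) => apply: (lin_linfun (f := f)) => ? /=
  | |- lin (fun x => GRing.scale _ _) => first [apply: lin_scaler | apply: lin_scalel]
  | |- lin _ => first [ lin_ext
     | apply: lin_mulk | apply: lin_kmul | apply: lin_mull | apply: lin_mulr ]
  end.
Ltac lin_tac := repeat (first [assumption | lin_step]).

(** * Functionals *)

Section Separation.
Variables (k : fieldType) (U W Z : vectType k).

Lemma coord_sep (u : U) : (forall phi : 'Hom(U, k^o), phi u = 0) -> u = 0.
Proof.
move=> u0; rewrite [u]coord_vbasis_sum big1 // => i _.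
have cL : lin (coord (vbasis {:U}) i : U -> k^o) by exact: lin_linear_fun.
by have := u0 (linfun (coord (vbasis {:U}) i : U -> k^o)); rewrite linfunE // => ->; rewrite scale0r.
Qed.

(** Evaluation at a basis of a separating [Q] embeds [U] into row vectors. Every functional factors
    through this embedding, and its values on the standard rows are its coefficients in that
    basis. *)
Lemma annihilator_sep (Q : {vspace 'Hom(U, k^o)}) :
  (forall u, (forall phi, phi \in Q -> phi u = 0) -> u = 0) -> Q = fullv.
Proof.
move=> sepQ; apply/vspaceP => phi; rewrite memvf.
pose q (i : 'I_(\dim Q)) : 'Hom(U, k^o) := (vbasis Q)`_i.
have qQ i : q i \in Q by apply: vbasis_mem; rewrite mem_nth ?size_tuple.
pose ev u : 'rV[k]_(\dim Q) := \row_i q i u.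
have evL : lin ev.
  by move=> a u v; apply/rowP => i; rewrite !mxE linearP.
have evK : lker (linfun ev) == 0%VS.
  rewrite -subv0; apply/subvP => u; rewrite memv_ker linfunE // memv0 => /eqP eu.
  apply/eqP/sepQ => psi psiQ; rewrite (coord_vbasis psiQ) sum_lfunE big1 // => i _.
  rewrite scale_lfunE; have /rowP/(_ i) := eu; rewrite !mxE /q => ->.
  by rewrite scaler0.
have phiE : phi = \sum_i ((phi \o (linfun ev)^-1)%VF (delta_mx 0 i) : k) *: q i.
  apply/lfunP => u; rewrite -[in LHS](lker0_lfunK evK u) linfunE //.
  rewrite [ev u]row_sum_delta -comp_lfunE linear_sum sum_lfunE.
  apply: eq_bigr => i _; rewrite linearZ scale_lfunE mxE /=.
  exact: mulrC.
by rewrite phiE memv_suml // => i _; rewrite memvZ.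
Qed.

Lemma tens_sep (t : tensor U W) :
  (forall (phi : 'Hom(U, k^o)) (psi : 'Hom(W, k^o)),
     tlift (fun u w => (phi u : k) * psi w : k^o) t = 0) -> t = 0.
Proof.
move=> t0.
pose cU i := linfun (coord (vbasis {:U}) i : U -> k^o) : 'Hom(U, k^o).
pose cW i := linfun (coord (vbasis {:W}) i : W -> k^o) : 'Hom(W, k^o).
have cUE i u : cU i u = coord (vbasis {:U}) i u.
  by rewrite linfunE //; exact: lin_linear_fun.
have cWE i u : cW i u = coord (vbasis {:W}) i u.
  by rewrite linfunE //; exact: lin_linear_fun.
apply/matrixP => i j; rewrite [RHS]mxE -(t0 (cU i) (cW j)) /tlift.
rewrite (bigD1 i) //= [X in _ + X]big1 ?addr0 => [|i' ne]; last first.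
  rewrite big1 // => j' _; rewrite cUE coord_free; last exact: basis_free (vbasisP _).
  by rewrite (negbTE ne) mul0r scaler0.
rewrite (bigD1 j) //= [X in _ + X]big1 ?addr0 => [|j' ne]; last first.
  rewrite cUE cWE !coord_free; try exact: basis_free (vbasisP _).
  by rewrite (negbTE ne) mulr0 scaler0.
rewrite cUE cWE !coord_free; try exact: basis_free (vbasisP _).
by rewrite !eqxx mulr1; exact/esym/mulr1.
Qed.

End Separation.

(** * Induced modules *)

Section InducedTheory.
Variables (k : fieldType) (A M : vectType k).
Variables (mul : A -> A -> A) (S : {vspace A}) (act : A -> M -> M).
Local Notation W := (balanced_rel mul S act).
Local Notation proj := (ind_proj mul S act).

Lemma lin_ind_proj : lin proj.
Proof.
by move=> a u v; rewrite /ind_proj !linearP.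
Qed.

Lemma ind_proj0 t : t \in W -> proj t = 0.
Proof.
move=> tW; rewrite /ind_proj.
have CW : (W^C :&: W = 0)%VS by rewrite capvC capv_compl.
have := @daddv_pi_add _ _ W^C%VS W t CW; rewrite addvC addv_complf memvf => /(_ isT).
rewrite [X in _ + X]daddv_pi_id ?capv_compl // -[X in _ = X]add0r => /addIr ->.
by rewrite linear0.
Qed.

Lemma ind_projK w : proj (vsval w) = w.
Proof.
rewrite /ind_proj daddv_pi_id ?subvsP ?vsvalK //.
by rewrite capvC capv_compl.
Qed.

Lemma vsval_ind_proj t : t - vsval (proj t) \in W.
Proof.
rewrite /ind_proj vsprojK ?memv_pi //.
have CW : (W^C :&: W = 0)%VS by rewrite capvC capv_compl.
have := @daddv_pi_add _ _ W^C%VS W t CW; rewrite addvC addv_complf memvf => /(_ isT).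
by move=> {1}<-; rewrite addrAC subrr add0r memv_pi.
Qed.

Lemma lin_ind_lift (Z : vectType k) (f : A -> M -> Z) :
  lin (ind_lift f : induced mul S act -> Z).
Proof. by move=> a u v; rewrite /ind_lift linearP (lin_tlift f lin_id). Qed.

(** [ind_lift] evaluates on the representative chosen in the complement. It differs from [t] by an
    element of [balanced_rel], on which a balanced map vanishes. *)
Lemma ind_lift_proj (Z : vectType k) (f : A -> M -> Z) t :
  bilin f -> (forall a s m, s \in S -> f (mul a s) m = f a (act s m)) ->
  ind_lift f (proj t) = tlift f t.
Proof.
move=> fL fS; have LL : lin (tlift f) by lin_tac.
apply/eqP; rewrite eq_sym /ind_lift -subr_eq0 -(linB LL).
have := vsval_ind_proj t; set w := _ - _.
rewrite -(linfunE LL) -memv_ker; apply/subvP/span_subvP => _ /allpairsP[[p m] /= [/allpairsP[[a s] /= [_ sS ->]] _ ->]] /=.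
rewrite memv_ker linfunE // linB // !tlift_tens // fS ?subrr //.
exact: vbasis_mem.
Qed.

(** The relations are imposed on basis vectors only; expanding [a], [m] and [s] in turn extends
    them. *)
Lemma ind_proj_balanced a s m :
  bilin mul -> bilin act -> s \in S -> proj (mul a s ⊗ m) = proj (a ⊗ act s m).
Proof.
move=> [mr ml] [ar al] sS; apply/eqP.
have pL := lin_ind_proj; rewrite -subr_eq0 -linB //; apply/eqP/ind_proj0.
have L1 : bilin (fun a m => mul a s ⊗ m - a ⊗ act s m).
  by split=> x; lin_tac; first [exact: ar | exact: ml].
rewrite -(tlift_tens a m L1) /tlift memv_suml // => i _.
rewrite memv_suml // => j _; rewrite memvZ //.
set e := _`_i; set e' := _`_j.
have L2 : lin (fun s => mul e s ⊗ e' - e ⊗ act s e').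
  apply: lin_sub; first exact: (lin_tensl _ (mr _)).
  exact: (lin_tensr _ (al _)).
rewrite (coord_vbasis sS) (lin_bigsum L2) memv_suml // => l _.
rewrite (linZ L2) memvZ // memv_span //; apply/allpairsP.
exists ((e, (vbasis S)`_l), e'); rewrite /= /e /e'.
by rewrite mem_nth ?size_tuple //; split=> //; apply/allpairsP; exists (e, (vbasis S)`_l); rewrite !mem_nth ?size_tuple.
Qed.

Lemma lin_ind_act a : lin (ind_act a : induced mul S act -> _).
Proof. exact: lin_ind_lift. Qed.

(** The associativity hypothesis says that left multiplication by [a] carries relations over [S] to
    relations over [S], so the action can be read off any representative. *)
Lemma ind_actE a b m :
  bilin mul -> bilin act ->
  (forall b s, s \in S -> mul a (mul b s) = mul (mul a b) s) ->
  ind_act a (proj (b ⊗ m)) = proj (mul a b ⊗ m).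
Proof.
move=> mL aL mA; rewrite /ind_act.
have fL : bilin (fun b m => proj (mul a b ⊗ m)).
  split=> x; apply: (lin_comp lin_ind_proj); lin_tac.
  exact: (mL.1 a).
rewrite ind_lift_proj ?tlift_tens // => c s m' sS.
by rewrite mA // ind_proj_balanced.
Qed.

End InducedTheory.

Global Opaque tens tlift.

(** * Drinfeld doubles *)

Definition trilin (k : fieldType) (U W Y Z : lmodType k) (F : U -> W -> Y -> Z) :=
  [/\ forall a b, lin (F a b), forall a c, lin (fun b => F a b c)
    & forall b c, lin (fun a => F a b c)].

(** Both sides are images under [tlift3 F] of the two iterated coproducts. [Delta] is a bare map
    because the rule serves Hopf algebras and braided Hopf algebras alike. *)
Lemma tlift_coassoc (k : fieldType) (U Z : vectType k) (Delta : U -> tensor U U)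
    (F : U -> U -> U -> Z) x :
  tlift (fun a b => tlift (fun c d => c ⊗ d ⊗ b) (Delta a)) (Delta x)
    = tlift (fun a b => a ⊗ Delta b) (Delta x) ->
  trilin F ->
  tlift (fun a b => tlift (F a) (Delta b)) (Delta x)
    = tlift (fun a b => tlift (fun c d => F c d b) (Delta a)) (Delta x).
Proof.
move=> coass [Fc Fb Fa].
have TL : lin (tlift3 F) by rewrite /tlift3; lin_tac.
have E a b : tlift3 F (a ⊗ Delta b) = tlift (F a) (Delta b).
  by rewrite /tlift3 tlift_tens //; lin_tac.
under eq_tlift => a b do rewrite -E.
rewrite -(lin_tlift_comp _ _ TL) -coass (lin_tlift_comp _ _ TL).
apply: eq_tlift => a b; rewrite (lin_tlift_comp _ _ TL); apply: eq_tlift => c d.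
by rewrite /tlift3 !tlift_tens //; lin_tac; try exact: Fa; exact: Fb.
Qed.

(* The antipode enters only through its values on units, counits and group-likes,
   so its defining axiom is left out. *)
Record hopfAxioms (k : fieldType) (H : hopfOps k) : Prop := HopfAxioms {
  hx_mulL : bilin (@ho_mul k H);
  hx_comulL : lin (@ho_comul k H);
  hx_counitL : lin (@ho_counit k H : H -> k^o);
  hx_antiL : lin (@ho_anti k H);
  hx_mulA : associative (@ho_mul k H);
  hx_mul1h : left_id (ho_one H) (@ho_mul k H);
  hx_mulh1 : right_id (ho_one H) (@ho_mul k H);
  hx_coassoc : forall x : H,
    tlift (fun a b => tlift (fun c d => c ⊗ d ⊗ b) (ho_comul a)) (ho_comul x)
    = tlift (fun a b => a ⊗ ho_comul b) (ho_comul x);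
  hx_counitl : forall x : H,
    tlift (fun a b => ho_counit a *: b) (ho_comul x) = x;
  hx_counitr : forall x : H,
    tlift (fun a b => ho_counit b *: a) (ho_comul x) = x;
  hx_counitM : forall x y : H,
    ho_counit (ho_mul x y) = ho_counit x * ho_counit y;
  hx_counitS : forall x : H, ho_counit (ho_anti x) = ho_counit x;
  hx_comul1 : ho_comul (ho_one H) = ho_one H ⊗ ho_one H;
  hx_anti1 : ho_anti (ho_one H) = ho_one H }.

(** Sweedler's [F (x_(1), x_(2), x_(3))], iterating the coproduct on the right factor as [comul3]
    does. *)
Definition sw3 (k : fieldType) (H : hopfOps k) (Z : vectType k)
    (F : H -> H -> H -> Z) (x : H) : Z :=
  tlift (fun a b => tlift (F a) (ho_comul b)) (ho_comul x).

(** These are the instances of [Delta (x y) = Delta x Delta y] and [S (x y) = S y S x] with a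
    group-like factor; [d] stands for the inverse of [c]. *)
Record grouplike (k : fieldType) (H : hopfOps k) (c d : H) : Prop := Grouplike {
  gl_comul : forall x,
    ho_comul (ho_mul c x)
      = tlift (fun a b => ho_mul c a ⊗ ho_mul c b) (ho_comul x);
  gl_comulr : forall x,
    ho_comul (ho_mul x c)
      = tlift (fun a b => ho_mul a c ⊗ ho_mul b c) (ho_comul x);
  gl_comulV : forall x,
    ho_comul (ho_mul x d)
      = tlift (fun a b => ho_mul a d ⊗ ho_mul b d) (ho_comul x);
  gl_anti : forall x, ho_anti (ho_mul x c) = ho_mul d (ho_anti x) }.

Section DoubleTheory.
Variables (k : fieldType) (H : hopfOps k).
Hypothesis HA : hopfAxioms H.
Local Notation mul := (@ho_mul k H).
Local Notation one := (ho_one H).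
Local Notation Delta := (@ho_comul k H).
Local Notation eps := (@ho_counit k H).
Local Notation anti := (@ho_anti k H).
Local Notation Hd := (hdual H).
Local Notation dmul := (@dual_mul k H).
Local Notation D := (drinfeld H).

Lemma lin_hmull (X : lmodType k) (f : X -> H) c : lin f -> lin (fun x => mul (f x) c).
Proof. exact: (lin_comp ((hx_mulL HA).2 c)). Qed.

Lemma lin_hmulr (X : lmodType k) (f : X -> H) c : lin f -> lin (fun x => mul c (f x)).
Proof. exact: (lin_comp ((hx_mulL HA).1 c)). Qed.

Lemma lin_hcomul (X : lmodType k) (f : X -> H) : lin f -> lin (fun x => Delta (f x)).
Proof. exact: (lin_comp (hx_comulL HA)). Qed.

Lemma lin_hcounit (X : lmodType k) (f : X -> H) :
  lin f -> lin (fun x => eps (f x) : k^o).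
Proof. exact: (lin_comp (hx_counitL HA)). Qed.

Lemma lin_hanti (X : lmodType k) (f : X -> H) : lin f -> lin (fun x => anti (f x)).
Proof. exact: (lin_comp (hx_antiL HA)). Qed.

Lemma lin_dual_form (f f' : Hd) :
  lin (fun x => tlift (fun a b => f a * f' b : k^o) (Delta x)).
Proof. exact: lin_tlift (hx_comulL HA). Qed.

Lemma dual_mulE (f f' : Hd) x :
  dmul f f' x = tlift (fun a b => f a * f' b : k^o) (Delta x).
Proof. by rewrite /dual_mul linfunE //; exact: lin_dual_form. Qed.

Lemma dual_oneE x : dual_one H x = eps x.
Proof. by rewrite /dual_one linfunE //; exact: hx_counitL. Qed.

Lemma lin_dmull (X : lmodType k) (f : X -> Hd) f' :
  lin f -> lin (fun x => dmul (f x) f').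
Proof.
move=> fL; apply: lin_linfun => [x|u]; first exact: lin_dual_form.
by apply: lin_tlift_fun => a b; apply: lin_mulk; apply: lin_lfunl.
Qed.

Lemma lin_dmulr (X : lmodType k) f (f' : X -> Hd) :
  lin f' -> lin (fun x => dmul f (f' x)).
Proof.
move=> fL; apply: lin_linfun => [x|u]; first exact: lin_dual_form.
by apply: lin_tlift_fun => a b; apply: lin_kmul; apply: lin_lfunl.
Qed.

Ltac lin_ext ::= first [apply: lin_hmull | apply: lin_hmulr | apply: lin_hcomul
  | apply: lin_hcounit | apply: lin_hanti | apply: lin_dmull | apply: lin_dmulr].

Section Sweedler.
Variable Z : vectType k.
Implicit Type F : H -> H -> H -> Z.

Lemma eq_sw3 F G : (forall a b c, F a b c = G a b c) -> sw3 F =1 sw3 G.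
Proof. by move=> FG x; do 2!apply: eq_tlift => ? ?. Qed.

Lemma lin_sw3_comp (W : vectType k) (h : Z -> W) F x :
  lin h -> h (sw3 F x) = sw3 (fun a b c => h (F a b c)) x.
Proof.
move=> hL; rewrite /sw3 (lin_tlift_comp _ _ hL); apply: eq_tlift => a b.
exact: lin_tlift_comp.
Qed.

Lemma sw3_sum I (r : seq I) (P : pred I) (F : I -> H -> H -> H -> Z) x :
  sw3 (fun a b c => \sum_(i <- r | P i) F i a b c) x
    = \sum_(i <- r | P i) sw3 (F i) x.
Proof.
rewrite /sw3 -tlift_sum; apply: eq_tlift => a b; exact: tlift_sum.
Qed.

Lemma tlift3_comul3 F x : trilin F -> tlift3 F (comul3 x) = sw3 F x.
Proof.
case=> Fc Fb Fa; rewrite /tlift3 /comul3.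
have TL : lin (tlift (fun u => tlift (F u))) by lin_tac.
rewrite (lin_tlift_comp _ _ TL); apply: eq_tlift => a b.
by rewrite tlift_tens //; lin_tac.
Qed.

Lemma sw3_coassoc F x : trilin F ->
  sw3 F x = tlift (fun a b => tlift (fun c d => F c d b) (Delta a)) (Delta x).
Proof.
exact/tlift_coassoc/(hx_coassoc HA).
Qed.

Lemma sw3_grouplike F c : trilin F -> Delta c = c ⊗ c -> sw3 F c = F c c c.
Proof.
case=> Fc Fb Fa cc; rewrite /sw3 cc tlift_tens; first by rewrite cc tlift_tens //; lin_tac; exact: Fb.
by lin_tac; exact: Fa.
Qed.

End Sweedler.

Lemma dual_mulA : associative dmul.
Proof.
move=> f g h; apply/lfunP => x; rewrite !dual_mulE.
transitivity (sw3 (fun a b c => f a * (g b * h c) : k^o) x).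
  apply: eq_tlift => a b; rewrite dual_mulE.
  by rewrite (lin_tlift_comp (h := fun y : k^o => f a * y : k^o)) //; lin_tac.
rewrite sw3_coassoc; last by split=> ? ?; lin_tac.
apply: eq_tlift => a b; rewrite dual_mulE.
rewrite (lin_tlift_comp (h := fun y : k^o => y * h b : k^o)); last by lin_tac.
by apply: eq_tlift => c d; rewrite mulrA.
Qed.

Lemma dual_mul1 f : dmul f (dual_one H) = f.
Proof.
apply/lfunP => x; rewrite dual_mulE -[in RHS](hx_counitr HA x).
rewrite (lin_tlift_comp _ _ (h := f)); last by lin_tac.
by apply: eq_tlift => a b; rewrite dual_oneE linearZ; exact: mulrC.
Qed.

Lemma dual_1mul f : dmul (dual_one H) f = f.
Proof.
apply/lfunP => x; rewrite dual_mulE -[in RHS](hx_counitl HA x).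
rewrite (lin_tlift_comp _ _ (h := f)); last by lin_tac.
by apply: eq_tlift => a b; rewrite dual_oneE linearZ.
Qed.

(** This is [<f_(1), a> <f_(3), c> f_(2)]. It removes the coproduct of [f] from the product of the
    double, leaving only the one of [h']. *)
Definition conjd (f : Hd) (a c : H) : Hd := linfun (fun x => f (mul a (mul x c)) : k^o).

Lemma conjdE f a c x : conjd f a c x = f (mul a (mul x c)).
Proof. by rewrite /conjd linfunE //; lin_tac. Qed.

Lemma lin_conjd1 (X : lmodType k) (f : X -> Hd) a c :
  lin f -> lin (fun x => conjd (f x) a c).
Proof. by move=> fL; apply: lin_linfun => ?; lin_tac. Qed.

Lemma lin_conjd2 (X : lmodType k) f (a : X -> H) c :
  lin a -> lin (fun x => conjd f (a x) c).
Proof. by move=> fL; apply: lin_linfun => ?; lin_tac. Qed.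

Lemma lin_conjd3 (X : lmodType k) f a (c : X -> H) :
  lin c -> lin (fun x => conjd f a (c x)).
Proof. by move=> fL; apply: lin_linfun => ?; lin_tac. Qed.

Ltac lin_ext ::= first [apply: lin_hmull | apply: lin_hmulr | apply: lin_hcomul
  | apply: lin_hcounit | apply: lin_hanti | apply: lin_dmull | apply: lin_dmulr
  | apply: lin_conjd1 | apply: lin_conjd2 | apply: lin_conjd3
  | apply: lin_mulk | apply: lin_kmul].

Local Notation e := (vbasis {:H}).
Let ed i : Hd := linfun (fun x : H => coord e i x : k^o).

Lemma edE i x : ed i x = coord e i x.
Proof. by rewrite /ed linfunE //; exact: lin_linear_fun. Qed.

Lemma lin_dual_comul (X : lmodType k) (f : X -> Hd) :
  lin f -> lin (fun x => dual_comul (f x)).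
Proof. by move=> fL; rewrite /dual_comul; lin_tac. Qed.

Lemma tlift_dual_comul (Z : vectType k) (G : Hd -> Hd -> Z) f : bilin G ->
  tlift G (dual_comul f) =
  \sum_i G (ed i) (linfun (fun y : H => f (mul e`_i y)) : Hd).
Proof.
move=> GL; rewrite /dual_comul (lin_bigsum (lin_tlift G lin_id)).
by apply: eq_bigr => i _; rewrite tlift_tens.
Qed.

Lemma tlift3_dual_comul3 (Z : vectType k) (G : Hd -> Hd -> Hd -> Z) f : trilin G ->
  tlift3 G (dual_comul3 f) =
  \sum_i \sum_j G (ed i) (ed j) (linfun (fun y : H => f (mul e`_i (mul e`_j y))) : Hd).
Proof.
case=> Gc Gb Ga; rewrite /tlift3 /dual_comul3.
have TL : lin (tlift (fun u => tlift (G u))) by lin_tac.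
rewrite (lin_tlift_comp _ _ TL) tlift_dual_comul; last first.
  by lin_tac; apply: lin_dual_comul.
apply: eq_bigr => i _; rewrite tlift_tens; last by lin_tac; exact: Ga.
rewrite tlift_dual_comul //; apply: eq_bigr => j _; congr (G _ _ _).
by apply/lfunP => y; rewrite !linfunE //; lin_tac.
Qed.

(** The coproduct of the dual is a sum over dual bases, and these sums are contracted by reading
    them as basis expansions of [conjd f a (anti c)] and of [a]. *)
Lemma double_mul_inner h f h' f' :
  tlift3 (fun f1 f2 f3 : Hd => tlift3 (fun h1 h2 h3 : H =>
      (f1 h1 * f3 (anti h3) : k) *: (mul h h2 ⊗ dmul f' f2))
    (comul3 h')) (dual_comul3 f)
  = sw3 (fun a b c => mul h b ⊗ dmul f' (conjd f a (anti c))) h' :> D.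
Proof.
rewrite tlift3_dual_comul3; last first.
  split=> ? ?; rewrite /tlift3; lin_tac.
under eq_bigr => i _ do under eq_bigr => j _ do
  (rewrite tlift3_comul3; last by split=> ? ?; lin_tac).
under eq_bigr => i _ do rewrite -sw3_sum.
rewrite -sw3_sum; apply: eq_sw3 => a b c.
have -> : conjd f a (anti c) = \sum_(j < \dim {:H}) (f (mul a (mul e`_j (anti c))) : k) *: ed j.
  apply/lfunP => x; rewrite conjdE sum_lfunE [in LHS](coord_vbasis_sum x).
  rewrite (lin_bigsum (f := fun x => f (mul a (mul x (anti c))))); last by lin_tac.
  apply: eq_bigr => j _; rewrite scale_lfunE edE.
  rewrite (linZ (f := fun x => f (mul a (mul x (anti c))))); last by lin_tac.
  exact: mulrC.
rewrite (lin_bigsum (f := fun q => mul h b ⊗ dmul f' q)); last by lin_tac.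
rewrite exchange_big; apply: eq_bigr => j _.
rewrite (linZ (f := fun q => mul h b ⊗ dmul f' q)); last by lin_tac.
rewrite -scaler_suml; congr (_ *: _).
(* The sum over [j] is settled; expanding [a] accounts for the remaining sum over [i], which comes
   from [f_(1)]. *)
rewrite [in RHS](coord_vbasis_sum a).
rewrite (lin_bigsum (f := fun x => f (mul x (mul e`_j (anti c))))); last by lin_tac.
apply: eq_bigr => i _; rewrite edE linfunE; last by lin_tac.
by rewrite (linZ (f := fun x => f (mul x (mul e`_j (anti c))))) //; lin_tac.
Qed.

Lemma lin_eq (U W : lmodType k) (f g : U -> W) : f =1 g -> lin g -> lin f.
Proof. by move=> fg gL a u v; rewrite !fg gL. Qed.

Lemma double_mulE h f h' f' :
  double_mul (h ⊗ f : D) (h' ⊗ f')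
  = sw3 (fun a b c => mul h b ⊗ dmul f' (conjd f a (anti c))) h'.
Proof.
have inner h0 f0 : bilin (fun h' f' =>
    sw3 (fun a b c => mul h0 b ⊗ dmul f' (conjd f0 a (anti c))) h' : D).
  by split=> ?; rewrite /sw3; lin_tac.
have innerL h0 f0 : bilin (fun h' f' =>
    tlift3 (fun f1 f2 f3 : Hd => tlift3 (fun h1 h2 h3 : H =>
      (f1 h1 * f3 (anti h3) : k) *: (mul h0 h2 ⊗ dmul f' f2))
    (comul3 h')) (dual_comul3 f0) : D).
  split=> x; [apply: (lin_eq (double_mul_inner _ _ _)) | ].
    exact: (inner _ _).1.
  apply: (lin_eq (g := fun h' => sw3 (fun a b c => mul h0 b ⊗ dmul x (conjd f0 a (anti c))) h')).
    by move=> ?; exact: double_mul_inner.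
  exact: (inner _ _).2.
rewrite /double_mul tlift_tens.
  by rewrite tlift_tens //; exact: double_mul_inner.
split=> x; apply: lin_tlift_fun => h1 f1 /=.
  apply: (lin_eq (fun f0 => double_mul_inner x f0 h1 f1)).
  by rewrite /sw3; lin_tac.
apply: (lin_eq (fun h0 => double_mul_inner h0 x h1 f1)).
by rewrite /sw3; lin_tac.
Qed.

Lemma double_mul_lin : bilin (@double_mul k H).
Proof.
by split=> x; rewrite /double_mul; [apply: lin_tlift_fun => ? ?|]; apply: lin_tlift lin_id.
Qed.

(** The unit is group-like, so only one term survives. The reversed order reflects that the double
    contains the opposite of the dual. *)
Lemma double_mulr_dual h f f' :
  double_mul (h ⊗ f : D) (one ⊗ f') = h ⊗ dmul f' f.
Proof.
rewrite double_mulE sw3_grouplike ?(hx_comul1 HA) //; last by split=> ? ?; lin_tac.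
rewrite (hx_mulh1 HA) (hx_anti1 HA); congr (_ ⊗ dmul _ _).
by apply/lfunP => x; rewrite conjdE (hx_mul1h HA) (hx_mulh1 HA).
Qed.

Lemma double_mul1 d : double_mul d (double_one H) = d.
Proof.
apply: (tens_ext (f := fun d => double_mul d (double_one H))) => //.
  exact: double_mul_lin.2.
by move=> h f; rewrite /double_one double_mulr_dual dual_1mul.
Qed.

(** For [f] the counit, [conjd f a (anti c)] is [eps a * eps c] times the counit, and the two
    counits contract the outer factors of the coproduct of [h']. *)
Lemma double_mull h h' f' :
  double_mul (h ⊗ dual_one H : D) (h' ⊗ f') = mul h h' ⊗ f'.
Proof.
rewrite double_mulE.
have conj1 a c : conjd (dual_one H) a (anti c) = (eps a * eps c) *: dual_one H.
  apply/lfunP => x; rewrite conjdE scale_lfunE !dual_oneE !(hx_counitM HA).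
  by rewrite (hx_counitS HA) mulrA mulrAC.
rewrite (eq_sw3 (G := fun a b c => eps a *: (eps c *: (mul h b ⊗ f')))); last first.
  move=> a b c; rewrite conj1 (linZ (f := dmul f')); last by lin_tac.
  by rewrite dual_mul1 (linZ (f := tens (mul h b))) ?scalerA //; lin_tac.
rewrite -[in RHS](hx_counitl HA h').
rewrite (lin_tlift_comp (h := fun x => mul h x ⊗ f')); last by lin_tac.
apply: eq_tlift => a b; rewrite -[b in RHS](hx_counitr HA).
rewrite (lin_tlift_comp (h := fun x => mul h (eps a *: x) ⊗ f')); last first.
  by lin_tac; apply: lin_scaler.
apply: eq_tlift => b' c.
rewrite (linZ (f := fun x => mul h x ⊗ f')); last by lin_tac.
by rewrite (linZ (f := fun x => mul h x ⊗ f')) //; lin_tac.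
Qed.

Section Grouplike.
Variables c d : H.
Hypothesis cdG : grouplike c d.

Lemma comul_grouplike : Delta c = c ⊗ c.
Proof.
rewrite -[c in LHS](hx_mulh1 HA) (gl_comul cdG) (hx_comul1 HA) tlift_tens.
  by rewrite (hx_mulh1 HA).
by lin_tac.
Qed.

Lemma anti_grouplike : anti c = d.
Proof.
by rewrite -[c](hx_mul1h HA) (gl_anti cdG) (hx_anti1 HA) (hx_mulh1 HA).
Qed.

Lemma double_mulr_grouplike h f :
  double_mul (h ⊗ f : D) (c ⊗ dual_one H) = mul h c ⊗ conjd f c d.
Proof.
rewrite double_mulE sw3_grouplike ?comul_grouplike //; last by split=> ? ?; lin_tac.
by rewrite dual_1mul anti_grouplike.
Qed.

Lemma sw3_mulr_grouplike (Z : vectType k) (F : H -> H -> H -> Z) x : trilin F ->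
  sw3 F (mul x c) = sw3 (fun a b b' => F (mul a c) (mul b c) (mul b' c)) x.
Proof.
case=> Fc Fb Fa; rewrite /sw3 (gl_comulr cdG).
rewrite (lin_tlift_comp (h := tlift _)); last by lin_tac.
apply: eq_tlift => a b; rewrite tlift_tens; last by lin_tac; exact: Fa.
rewrite (gl_comulr cdG) (lin_tlift_comp (h := tlift _)); last by lin_tac.
by apply: eq_tlift => a' b'; rewrite tlift_tens //; lin_tac; exact: Fb.
Qed.

Lemma conjd_dual_mul p q : conjd (dmul p q) c d = dmul (conjd p c d) (conjd q c d).
Proof.
apply/lfunP => x; rewrite conjdE !dual_mulE (gl_comul cdG).
rewrite (lin_tlift_comp (h := tlift _)); last by lin_tac.
rewrite (gl_comulV cdG) (lin_tlift_comp (h := tlift _)); last by lin_tac.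
apply: eq_tlift => a b; rewrite !tlift_tens ?conjdE //; lin_tac.
Qed.

End Grouplike.

(* Associativity with [s] on the right is all that induced modules require, and
   it only has to be checked on generators. *)
Definition rassoc (s : D) :=
  forall d b : D, double_mul d (double_mul b s) = double_mul (double_mul d b) s.

Lemma rassocP s :
  (forall h f h' f', double_mul (h ⊗ f) (double_mul (h' ⊗ f') s)
     = double_mul (double_mul (h ⊗ f : D) (h' ⊗ f')) s) -> rassoc s.
Proof.
have [ml mr] := double_mul_lin.
move=> ass d b.
apply: (tens_ext (f := fun d => double_mul d (double_mul b s))
  (g := fun d => double_mul (double_mul d b) s)) => [||h f].
- exact: mr.
- exact: lin_comp (mr s) (mr b).
apply: (tens_ext (f := fun b => double_mul (h ⊗ f) (double_mul b s))
  (g := fun b => double_mul (double_mul (h ⊗ f : D) b) s)) => [||h' f'].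
- exact: lin_comp (ml _) (mr s).
- exact: lin_comp (mr s) (ml _).
exact: ass.
Qed.

Lemma rassoc_dual f : rassoc (one ⊗ f).
Proof.
apply: rassocP => h p h' p'; rewrite double_mulr_dual !double_mulE.
rewrite (lin_sw3_comp _ _ (h := fun t => double_mul t _)); last exact: double_mul_lin.2.
by apply: eq_sw3 => a b c; rewrite double_mulr_dual dual_mulA.
Qed.

(** Moving [c] through the coproduct and the antipode of [h' c] turns both sides into the same
    Sweedler sum: on either side [p] is evaluated at [a c x d S(b')]. *)
Lemma rassoc_grouplike c d : grouplike c d -> rassoc (c ⊗ dual_one H).
Proof.
move=> cdG; apply: rassocP => h p h' p'; rewrite (double_mulr_grouplike cdG) !double_mulE.
rewrite (lin_sw3_comp _ _ (h := fun t => double_mul t _)); last exact: double_mul_lin.2.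
rewrite (sw3_mulr_grouplike cdG); last by split=> ? ?; lin_tac.
apply: eq_sw3 => a b b'; rewrite (double_mulr_grouplike cdG) (hx_mulA HA).
rewrite (conjd_dual_mul cdG) (gl_anti cdG); congr (_ ⊗ dmul _ _).
by apply/lfunP => x; rewrite !conjdE !(hx_mulA HA).
Qed.

Lemma rassoc_lin a s t : rassoc s -> rassoc t -> rassoc (a *: s + t).
Proof.
have [ml mr] := double_mul_lin.
by move=> rs rt d b; rewrite !ml rs rt.
Qed.

Lemma rassoc_mul s t : rassoc s -> rassoc t -> rassoc (double_mul s t).
Proof. by move=> rs rt d b; rewrite (rt b s) (rt d) rs (rt (double_mul d b) s). Qed.

Lemma rassoc0 : rassoc 0.
Proof.
have [ml mr] := double_mul_lin.
by move=> d b; rewrite !(lin0 (ml _)).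
Qed.

(** * Subalgebras of the double given by generators *)

Section Generated.
Variable X : {vspace D}.
Let Y i := iter i (double_prodv X) <[double_one H]>%VS.
Let S j := (\sum_(i < j) Y i)%VS.

Lemma double_prodv_mem (U : {vspace D}) x y :
  x \in X -> y \in U -> double_mul x y \in double_prodv X U.
Proof.
have [ml mr] := double_mul_lin.
move=> xX yU; rewrite (coord_vbasis xX) (lin_bigsum (mr _)) memv_suml // => i _.
rewrite (linZ (mr _)) memvZ // (coord_vbasis yU) (lin_bigsum (ml _)).
rewrite memv_suml // => j _; rewrite (linZ (ml _)) memvZ //.
apply/memv_span/allpairsP; exists ((vbasis X)`_i, (vbasis U)`_j).
by rewrite !mem_nth ?size_tuple.
Qed.

Lemma double_prodv_sub (U Z : {vspace D}) :
  (forall x y, x \in X -> y \in U -> double_mul x y \in Z) ->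
  (double_prodv X U <= Z)%VS.
Proof.
move=> XUZ; apply/span_subvP => _ /allpairsP[[x y] [xX yU ->]].
by apply: XUZ; exact: vbasis_mem.
Qed.

Let SS j : S j.+1 = (S j + Y j)%VS.
Proof. by rewrite /S big_ord_recr. Qed.

Let S_mul j x s : x \in X -> s \in S j -> double_mul x s \in S j.+1.
Proof.
move=> xX /memv_sumP[v vY ->]; rewrite (lin_bigsum (double_mul_lin.1 x)).
apply: memv_suml => i _; rewrite /S.
have : double_mul x (v i) \in Y i.+1 by apply: double_prodv_mem => //; exact: vY.
by apply/subvP; apply: (sumv_sup (lift ord0 i)) => //; rewrite lift0.
Qed.

Let YS_step j : (Y j <= S j)%VS -> (Y j.+1 <= S j.+1)%VS.
Proof.
move=> YS; apply: double_prodv_sub => x y xX yY; apply: S_mul => //.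
exact: (subvP YS).
Qed.

(** If the power with index [\dim {:D}] were not absorbed by the earlier ones, the partial sums
    would grow strictly at each step, and their dimension would exceed that of [D]. *)
Let SdimS : S (\dim {:D}).+1 = S (\dim {:D}).
Proof.
suff YS : (Y (\dim {:D}) <= S (\dim {:D}))%VS by rewrite SS; apply/addv_idPl.
apply/negPn/negP => nYS.
have dimS j : (j <= (\dim {:D}).+1)%N -> (j <= \dim (S j))%N.
  elim: j => // j IH jd; have jD := ltnW jd.
  apply: leq_ltn_trans (IH jD) _.
  (* Absorption at [j] would propagate upwards by [YS_step] and reach the index excluded by
     [nYS]. *)
  have nYSj : ~~ (Y j <= S j)%VS.
    apply: contra nYS => YSj; rewrite ltnS in jd; rewrite -(subnKC jd).
    by elim: (_ - _)%N => [|m IHm]; rewrite ?addn0 // addnS; exact: YS_step.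
  rewrite (leq_trans _ (_ : (\dim (S j) < \dim (S j.+1))%N)) //.
  rewrite SS (ltn_leqif (dimv_leqif_sup (addvSl _ _))) subv_add subvv.
  by [].
have := dimS _ (leqnn _); rewrite leqNgt ltnS.
by rewrite dimvS ?subvf.
Qed.

(** Passing to the sum with one more term guarantees that the index 0 exists, even if [D] has
    dimension 0. *)
Lemma double_gen_one : double_one H \in double_gen X.
Proof.
rewrite -[double_gen X]/(S _) -SdimS /S.
have := memv_line (double_one H).
by apply/subvP; exact: (sumv_sup ord0).
Qed.

Lemma double_gen_mul x s :
  x \in X -> s \in double_gen X -> double_mul x s \in double_gen X.
Proof.
move=> xX sX; rewrite -[double_gen X]/(S (\dim {:D})) -SdimS.
exact: S_mul.
Qed.

(** The powers are iterated left multiplications, so the rule speaks of a generator times an element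
    and can be used before associativity is known. *)
Lemma double_gen_ind (P : D -> Prop) :
  (forall a s t, P s -> P t -> P (a *: s + t)) -> P 0 -> P (double_one H) ->
  (forall x s, x \in X -> P s -> P (double_mul x s)) ->
  forall s, s \in double_gen X -> P s.
Proof.
move=> PL P0 P1 PM s /memv_sumP[v vY ->].
have PD s1 s2 : P s1 -> P s2 -> P (s1 + s2).
  by move=> P1' P2'; rewrite -[s1]scale1r; exact: PL.
have PZ a s1 : P s1 -> P (a *: s1) by move=> ?; rewrite -[_ *: _]addr0; exact: PL.
apply: (big_ind P) => // i _.
elim: (i : nat) (v i) (vY i isT) => /= [_ /vlineP[c ->]|j IH y]; first exact: PZ.
rewrite /double_prodv => yL; rewrite (@coord_span _ _ _ (in_tuple _) y yL).
apply: (big_ind P) => // l _; apply: PZ.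
have /(mem_nth 0)/allpairsP[[x z] /= [xX zY ->]] := ltn_ord l.
by apply: PM; [exact: vbasis_mem xX | apply: IH; exact: vbasis_mem zY].
Qed.

Lemma double_gen_rassoc :
  (forall x, x \in X -> rassoc x) -> forall s, s \in double_gen X -> rassoc s.
Proof.
move=> rX; apply: double_gen_ind => [a s t|||x s xX rs].
- exact: rassoc_lin.
- exact: rassoc0.
- exact: rassoc_dual.
- by apply: rassoc_mul => //; exact: rX.
Qed.

End Generated.
End DoubleTheory.

(** * The modules [M(g, rho)] *)

Section GroupAlgebraTheory.
Variables (k : fieldType) (gT : finGroupType).
Local Notation kG := (grpalg k gT).

Lemma lin_glift (X : lmodType k) (Z : lmodType k) (f : gT -> Z) (a : X -> kG) :
  lin a -> lin (fun x => glift f (a x)).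
Proof.
move=> aL; rewrite /glift; apply: lin_sum => g; apply: lin_scalel => c u v.
by rewrite aL !ffunE.
Qed.

Lemma lin_glift_fun (X : lmodType k) (Z : lmodType k) (f : X -> gT -> Z) (a : kG) :
  (forall g, lin (f^~ g)) -> lin (fun x => glift (f x) a).
Proof. by move=> fL; rewrite /glift; apply: lin_sum => g; exact: lin_scaler. Qed.

Lemma glift_gelt (Z : lmodType k) (f : gT -> Z) g : glift f (gelt g) = f g.
Proof.
rewrite /glift (bigD1 g) //= ffunE eqxx scale1r big1 ?addr0 // => h /negbTE hg.
by rewrite ffunE hg scale0r.
Qed.

Lemma gelt_sum (a : kG) : a = \sum_g (a g : k) *: gelt g.
Proof.
apply/ffunP => x; rewrite sum_ffunE (bigD1 x) //= !ffunE eqxx big1 ?addr0.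
  exact/esym/mulr1.
by move=> h /negbTE hx; rewrite !ffunE eq_sym hx; exact: mulr0.
Qed.

Lemma grpalg_ext (Z : lmodType k) (f h : kG -> Z) :
  lin f -> lin h -> (forall g, f (gelt g) = h (gelt g)) -> f =1 h.
Proof.
move=> fL hL fh a; rewrite [a]gelt_sum (lin_bigsum fL) (lin_bigsum hL).
by apply: eq_bigr => g _; rewrite (linZ fL) (linZ hL) fh.
Qed.

Local Notation mul := (@ho_mul k (groupHopf k gT)).

Lemma gmulE g h : mul (gelt g) (gelt h) = gelt (g * h)%g.
Proof. by rewrite /= !glift_gelt. Qed.

Lemma lin_gmul : bilin mul.
Proof.
by split=> x /=; [apply: lin_glift_fun => ?|]; apply: lin_glift; exact: lin_id.
Qed.

Lemma gmulA : associative mul.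
Proof.
have [mr ml] := lin_gmul.
move=> a b c; move: a; apply: grpalg_ext => [||x].
- exact: ml.
- exact: lin_comp (ml c) (ml b).
move: b; apply: grpalg_ext => [||y].
- exact: lin_comp (mr _) (ml c).
- exact: lin_comp (ml c) (mr _).
move: c; apply: grpalg_ext => [||z].
- exact: lin_comp (mr _) (mr _).
- exact: mr.
by rewrite !gmulE mulgA.
Qed.

Lemma subgrpalg_ind (C : {set gT}) (P : kG -> Prop) :
  (forall a s t, P s -> P t -> P (a *: s + t)) -> P 0 ->
  (forall c, c \in C -> P (gelt c)) -> forall s, s \in subgrpalg k C -> P s.
Proof.
move=> PL P0 PC s; rewrite /subgrpalg => sC.
rewrite (@coord_span _ _ _ (in_tuple _) s sC).
apply: (big_ind P) => // [s1 s2 P1 P2|i _].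
  by rewrite -[s1]scale1r; exact: PL.
rewrite -[_ *: _]addr0; apply: PL => //.
have /(mem_nth 0)/mapP[c cC ->] := ltn_ord i.
by apply: PC; move: cC; rewrite mem_enum.
Qed.

End GroupAlgebraTheory.

(** [mx_irreducible] concerns row vectors, while here [rho] acts on columns. The rows annihilating
    [U] form a row submodule: if it is everything then [U] is 0, and if it is 0 then [U] has
    dimension at least [n]. *)
Lemma col_irreducible (k : fieldType) (gT : finGroupType) (G : {group gT}) n
    (rho : mx_representation k G n) (U : {vspace 'cV[k]_n}) :
  mx_irreducible rho -> (forall c u, c \in G -> u \in U -> rho c *m u \in U) ->
  U != 0%VS -> U = fullv.
Proof.
case=> _ _ irr stab U0.
pose B : 'M[k]_(n, \dim U) := \matrix_(i, j) (vbasis U)`_j i 0.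
have BU r (K : 'M[k]_(r, n)) : K *m B = 0 -> forall u, u \in U -> K *m u = 0.
  move=> KB u uU; rewrite (coord_vbasis uU) linear_sum big1 // => j _.
  rewrite linearZ /=; suff -> : K *m (vbasis U)`_j = col j (K *m B).
    have -> : col j (K *m B) = 0 by apply/colP => i; rewrite KB !mxE.
    by rewrite scaler0.
  apply/colP => i; rewrite !mxE; apply: eq_bigr => l _.
  by rewrite mxE.
have UB r (K : 'M[k]_(r, n)) : (forall u, u \in U -> K *m u = 0) -> K *m B = 0.
  move=> KU; apply/matrixP => i j; rewrite !mxE.
  have bU : (vbasis U)`_j \in U by apply: vbasis_mem; rewrite mem_nth ?size_tuple.
  have /colP/(_ i) := KU _ bU; rewrite !mxE => E0; rewrite -[RHS]E0.
  by apply: eq_bigr => l _; rewrite mxE.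
pose K := kermx B; have KB : K *m B = 0 by exact: mulmx_ker.
have modK : mxmodule rho K.
  apply/mxmoduleP => c cG; apply/sub_kermxP/UB => u uU.
  by rewrite -mulmxA; apply: BU => //; exact: stab.
have [K0 | nK0] := eqVneq K 0; last first.
  have /submxP[X X1] := irr _ modK (submx1 _) nK0.
  have B0 : 1%:M *m B = 0 by rewrite X1 -mulmxA KB mulmx0.
  case/negP: U0; rewrite -subv0; apply/subvP => u /(BU _ _ B0).
  by rewrite mul1mx => ->; rewrite mem0v.
have : row_free B by rewrite -kermx_eq0 -/K K0.
rewrite -row_leq_rank => /leq_trans/(_ (rank_leq_col _)) nU.
apply/eqP; rewrite eqEdim subvf dimvf /=.
by apply: leq_trans nU; rewrite /dim /= muln1.
Qed.

Section SimpleDGTheory.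
Variables (k : fieldType) (gT : finGroupType) (g : gT) (n : nat).
Variable rho : mx_representation k 'C[g]%g n.
Local Notation kG := (groupHopf k gT).
Local Notation mul := (@ho_mul k kG).
Local Notation M := (simpleDG rho).
Local Notation act := (cent_act rho).
Local Notation S := (subgrpalg k 'C[g]%g).
Local Notation proj := (ind_proj mul S act).
Local Notation pt x u := (proj (gelt x ⊗ u)).

Lemma lin_cent_act : bilin act.
Proof.
split=> [a|w] c u v; rewrite /cent_act.
  rewrite scaler_sumr -big_split /=; apply: eq_bigr => x _.
  by rewrite linearP /= scalerDr !scalerA mulrC.
rewrite scaler_sumr -big_split /=; apply: eq_bigr => x _.
by rewrite !ffunE scalerDl scalerA.
Qed.

Lemma cent_act_gelt c u : c \in 'C[g]%g -> act (gelt c) u = rho c *m u.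
Proof.
move=> cC; rewrite /cent_act (bigD1 c) //= ffunE eqxx scale1r big1 ?addr0 //.
by move=> x /andP[_ /negbTE xc]; rewrite ffunE xc scale0r.
Qed.

Lemma gelt_subgrpalg (C : {set gT}) c : c \in C -> (gelt c : grpalg k gT) \in subgrpalg k C.
Proof. by move=> cC; apply/memv_span/mapP; exists c => //; rewrite mem_enum. Qed.

Lemma simpleDG_ind (P : M -> Prop) :
  (forall a s t, P s -> P t -> P (a *: s + t)) -> P 0 ->
  (forall x u, P (pt x u)) -> forall m, P m.
Proof.
have pL := @lin_ind_proj _ _ _ mul S act.
move=> PL P0 Pxu m; rewrite -(ind_projK m).
move: (vsval m); apply: tens_ind => [a s t|| a u].
- by rewrite pL; exact: PL.
- by rewrite (lin0 pL).
rewrite [a]gelt_sum (lin_bigsum (f := fun a : grpalg k gT => a ⊗ u)); last by lin_tac.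
rewrite (lin_bigsum pL); apply: (big_ind P) => // [s1 s2 P1 P2|i _].
  by rewrite -[s1]scale1r; exact: PL.
rewrite (linZ (f := fun a : grpalg k gT => a ⊗ u)); last by lin_tac.
by rewrite (linZ pL) -[_ *: _]addr0; exact: PL.
Qed.

Lemma simpleDG_ext (Z : lmodType k) (f h : M -> Z) :
  lin f -> lin h -> (forall x u, f (pt x u) = h (pt x u)) -> f =1 h.
Proof.
move=> fL hL fh; apply: simpleDG_ind => // [a s t fs ft|].
  by rewrite fL hL fs ft.
by rewrite (lin0 fL) (lin0 hL).
Qed.

Definition simpleDG_grp (h : gT) (m : M) : M := ind_act (gelt h) m.

Lemma simpleDG_grpE h x u : simpleDG_grp h (pt x u) = (pt (h * x)%g u).
Proof.
rewrite /simpleDG_grp ind_actE ?gmulE //; first exact: lin_gmul.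
- exact: lin_cent_act.
- by move=> ? ? _; exact: gmulA.
Qed.

Lemma lin_simpleDG_grp h : lin (simpleDG_grp h). Proof. exact: lin_ind_act. Qed.

Lemma simpleDG_grpM h h' m : simpleDG_grp (h * h')%g m = simpleDG_grp h (simpleDG_grp h' m).
Proof.
apply: (simpleDG_ext (f := simpleDG_grp (h * h')%g) (h := fun m => simpleDG_grp h (simpleDG_grp h' m))).
- exact: lin_simpleDG_grp.
- exact: lin_comp (lin_simpleDG_grp _) (lin_simpleDG_grp _).
by move=> x u; rewrite !simpleDG_grpE mulgA.
Qed.

Lemma simpleDG_grp1 m : simpleDG_grp 1%g m = m.
Proof.
apply: (simpleDG_ext (f := simpleDG_grp 1%g) (h := id)) => //; first exact: lin_simpleDG_grp.
by move=> x u; rewrite simpleDG_grpE mul1g.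
Qed.

Lemma simpleDG_cent x c u : c \in 'C[g]%g -> (pt (x * c)%g u) = (pt x (rho c *m u)).
Proof.
move=> cC; rewrite -gmulE ind_proj_balanced ?cent_act_gelt //.
- exact: lin_gmul.
- exact: lin_cent_act.
- exact: gelt_subgrpalg.
Qed.

Let phi (f : hdual kG) (a : grpalg k gT) : grpalg k gT :=
  glift (fun x => (f (gelt (x * g * x^-1)%g) : k) *: gelt x) a.

Let lin_phi f : lin (phi f). Proof. exact: lin_glift lin_id. Qed.

(** An element [c] of the centralizer of [g] does not change the conjugate:
    [(x c) g (x c)^-1 = x g x^-1]. *)
Let phi_mul f a s : s \in S -> phi f (mul a s) = mul (phi f a) s.
Proof.
have [mr ml] := @lin_gmul k gT.
apply: (subgrpalg_ind (P := fun s => phi f (mul a s) = mul (phi f a) s)) => [c u v|| c cC].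
- by rewrite !mr lin_phi => -> ->.
- by rewrite !(lin0 (mr _)) (lin0 (lin_phi f)).
move: a; apply: grpalg_ext => [||x].
- exact: lin_comp (lin_phi f) (ml _).
- exact: lin_comp (ml _) (lin_phi f).
rewrite gmulE /phi !glift_gelt (linZ (ml _)) gmulE; congr ((f (gelt _) : k) *: _).
have cg : (c * g = g * c)%g by apply/cent1P.
by rewrite invMg -!mulgA (mulgA c g) cg -mulgA mulKVg.
Qed.

Lemma lin_simpleDG_fun f : lin (simpleDG_fun (rho := rho) f).
Proof. exact: lin_ind_lift. Qed.

Lemma simpleDG_funE f x u :
  simpleDG_fun f (pt x u) = (f (gelt (x * g * x^-1)%g) : k) *: (pt x u).
Proof.
have pL := @lin_ind_proj _ _ _ mul S act.
have tL u0 : lin (fun a : grpalg k gT => proj (a ⊗ u0)).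
  by apply: (lin_comp pL); lin_tac.
have fL : bilin (fun (a : grpalg k gT) u => proj (phi f a ⊗ u)).
  split=> y; first by apply: (lin_comp pL); lin_tac.
  exact: lin_comp (tL _) (lin_phi f).
rewrite /simpleDG_fun ind_lift_proj //.
  by rewrite tlift_tens // /phi glift_gelt (linZ (tL u)).
move=> a s w sS; rewrite -!/(phi _ _) phi_mul // ind_proj_balanced //.
- exact: lin_gmul.
- exact: lin_cent_act.
Qed.

Lemma lin_simpleDG_funl (X : lmodType k) (f : X -> hdual kG) m :
  lin f -> lin (fun x => simpleDG_fun (f x) m : M).
Proof.
move=> fL; move: m; apply: simpleDG_ind => [a s t sL tL | | y u] c p q.
- rewrite !lin_simpleDG_fun sL tL scalerDr !scalerDr !scalerA mulrC -!addrA.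
  by congr (_ + _); rewrite addrCA.
- by rewrite !(lin0 (lin_simpleDG_fun _)) scaler0 addr0.
by rewrite !simpleDG_funE fL add_lfunE scale_lfunE scalerDl scalerA.
Qed.

Lemma simpleDG_funM (p f f' : hdual kG) m :
  (forall z, p (gelt z) = f (gelt z) * f' (gelt z) :> k) ->
  simpleDG_fun p m = simpleDG_fun f (simpleDG_fun f' m) :> M.
Proof.
move=> pff; apply: (simpleDG_ext (f := simpleDG_fun p)
  (h := fun m => simpleDG_fun f (simpleDG_fun f' m))) => [||x u].
- exact: lin_simpleDG_fun.
- exact: lin_comp (lin_simpleDG_fun _) (lin_simpleDG_fun _).
rewrite !simpleDG_funE (linZ (lin_simpleDG_fun _)) simpleDG_funE scalerA pff.
by rewrite mulrC.
Qed.

Lemma simpleDG_fun1 (p : hdual kG) m :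
  (forall z, p (gelt z) = 1) -> simpleDG_fun p m = m :> M.
Proof.
move=> p1; apply: (simpleDG_ext (f := simpleDG_fun p) (h := id)) => // [|x u].
  exact: lin_simpleDG_fun.
by rewrite simpleDG_funE p1 scale1r.
Qed.

Lemma simpleDG_fun_simpleDG_grp (f p : hdual kG) h m :
  (forall z, p (gelt z) = f (gelt (h * z * h^-1)%g)) ->
  simpleDG_fun f (simpleDG_grp h m) = simpleDG_grp h (simpleDG_fun p m) :> M.
Proof.
move=> pf; apply: (simpleDG_ext (f := fun m => simpleDG_fun f (simpleDG_grp h m))
  (h := fun m => simpleDG_grp h (simpleDG_fun p m))) => [||x u].
- exact: lin_comp (lin_simpleDG_fun _) (lin_simpleDG_grp _).
- exact: lin_comp (lin_simpleDG_grp _) (lin_simpleDG_fun _).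
rewrite simpleDG_grpE !simpleDG_funE (linZ (lin_simpleDG_grp _)) simpleDG_grpE pf.
by rewrite invMg !mulgA.
Qed.

Lemma simpleDG_actE a f m :
  simpleDG_act (a ⊗ f) m = glift (fun h => simpleDG_grp h (simpleDG_fun f m)) a :> M.
Proof.
have aL m0 : lin (fun a => ind_act a m0 : M).
  move: m0; apply: simpleDG_ind => [c s t sL tL | | y u] c' p q.
  - rewrite !lin_ind_act sL tL !scalerDr !scalerA mulrC -!addrA.
    by congr (_ + _); rewrite addrCA.
  - by rewrite !(lin0 (lin_ind_act _)) scaler0 addr0.
  have E b : ind_act b (pt y u) = proj (mul b (gelt y) ⊗ u).
    apply: ind_actE; [exact: lin_gmul | exact: lin_cent_act |].
    by move=> ? ? _; exact: gmulA.
  rewrite !E (lin_gmul _ _).2 (lin_tensl _ lin_id) lin_ind_proj //.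
rewrite /simpleDG_act tlift_tens; last first.
  split=> x; first exact: lin_comp (lin_ind_act _) (lin_simpleDG_funl _ lin_id).
  exact: aL.
rewrite [a in LHS]gelt_sum (lin_bigsum (aL _)); apply: eq_bigr => h _.
by rewrite (linZ (aL _)).
Qed.

Hypothesis irr : mx_irreducible rho.

(** [cent_act] vanishes on group elements outside the centralizer, so it is a balanced map on all of
    [kG (x) U] and induces a retraction sending [1 (x) u] to [u]. *)
Lemma simpleDG_neq0 u : u != 0 -> (pt 1%g u) != 0.
Proof.
have [ar al] := lin_cent_act.
apply: contra_neq => p0.
suff : ind_lift act (pt 1%g u) = u by rewrite p0 (lin0 (lin_ind_lift _)).
rewrite ind_lift_proj ?tlift_tens ?cent_act_gelt ?repr_mx1 ?mul1mx //; try exact: lin_cent_act.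
move=> a s w sS; have [mr ml] := @lin_gmul k gT.
move: s sS; apply: subgrpalg_ind => [c s t Es Et||c cC].
- by rewrite mr !al Es Et ar.
- by rewrite (lin0 (mr _)) !(lin0 (al _)) (lin0 (ar _)).
move: a; apply: grpalg_ext => [||x].
- exact: lin_comp (al _) (ml _).
- exact: al.
rewrite gmulE [act (gelt c) w]cent_act_gelt //.
have [xC | xC] := boolP (x \in 'C[g]%g).
  by rewrite !cent_act_gelt ?groupM // repr_mxM // mulmxA.
have act0 y v : y \notin 'C[g]%g -> act (gelt y) v = 0.
  move=> yC; rewrite /cent_act big1 // => z zC; rewrite ffunE.
  by case: eqP zC yC => [-> -> //|]; rewrite scale0r.
by rewrite !act0 // groupMr.
Qed.

Lemma simpleDG_nontrivial : exists m : M, m != 0.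
Proof.
have [_ n0 _] := irr.
have [u nu] : exists u : 'cV[k]_n, u != 0.
  have [i j] : exists i : 'I_n, True.
    by case: (n) (1%:M : 'M[k]_n) n0 => [|n'] I1 I0; [rewrite [I1]flatmx0 eqxx in I0 | exists ord0].
  exists (delta_mx i 0); apply: contraNneq (oner_neq0 k) => /matrixP/(_ i 0).
  by rewrite !mxE !eqxx => /eqP.
by exists (pt 1%g u); exact: simpleDG_neq0.
Qed.

(** The delta functions cut [P] into its parts over the conjugates of [g]. A nonzero part can be
    translated to the part over [g] itself, which is a copy of the irreducible representation, and
    translating back gives all of [M]. *)
Lemma simpleDG_simple (P : {vspace M}) :
  (forall h m, m \in P -> simpleDG_grp h m \in P) ->
  (forall f m, m \in P -> simpleDG_fun f m \in P) ->
  P != 0%VS -> P = fullv.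
Proof.
move=> Pg Pf P0.
have pL := @lin_ind_proj _ _ _ mul S act.
have uL y : lin (fun u => (pt y u)) by apply: (lin_comp pL); lin_tac.
pose dl t : hdual kG := linfun (fun a : grpalg k gT => a t).
have dlE t z : dl t (gelt z) = (t == z)%:R.
  by rewrite linfunE ?ffunE // => c u v; rewrite !ffunE.
have sumd (m : M) : \sum_t simpleDG_fun (dl t) m = m.
  apply: (simpleDG_ext (f := fun m => \sum_t simpleDG_fun (dl t) m) (h := id)) => // [|x u].
    by apply: lin_sum => t; exact: lin_simpleDG_fun.
  rewrite (bigD1 (x * g * x^-1)%g) //= simpleDG_funE dlE eqxx scale1r big1 ?addr0 // => t.
  by move=> /negbTE nt; rewrite simpleDG_funE dlE nt scale0r.
have [p pP p0] : exists2 p, p \in P & p != 0.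
  by exists (vpick P); rewrite ?memv_pick ?vpick0.
have [t q0] : exists t, simpleDG_fun (dl t) p != 0.
  apply/existsP; apply: contraNT p0; rewrite negb_exists => /forallP q0.
  by rewrite -(sumd p) big1 // => t _; apply/eqP; rewrite -[_ == _]negbK.
have qP := Pf (dl t) _ pP.
(* The point [t] must be a conjugate of [g], since otherwise its delta function acts by zero. *)
have [x0 /eqP x0t | nx] := pickP (fun x => (x * g * x^-1)%g == t); last first.
  case/eqP: q0; apply: (simpleDG_ext (f := simpleDG_fun (dl t)) (h := fun _ => 0)).
  - exact: lin_simpleDG_fun.
  - exact: lin_cst0.
  by move=> x u; rewrite simpleDG_funE dlE eq_sym nx scale0r.
(* The part over [t] is [x0 (x) U]: any [x] conjugating [g] to [t] differs from [x0] by an element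
   of the centralizer. *)
have qE m : exists u, simpleDG_fun (dl t) m = (pt x0 u).
  move: m; apply: simpleDG_ind => [a s s' [u Eu] [v Ev]||x u].
  - by exists (a *: u + v); rewrite lin_simpleDG_fun Eu Ev uL.
  - by exists 0; rewrite (lin0 (lin_simpleDG_fun _)) (lin0 (uL _)).
  rewrite simpleDG_funE dlE; case: eqP => [tx | _]; last first.
    by exists 0; rewrite scale0r (lin0 (uL _)).
  exists (rho (x0^-1 * x)%g *m u); rewrite -simpleDG_cent ?mulKVg ?scale1r //.
  apply/cent1P; rewrite /commute; apply: (mulgI x0); rewrite !mulgA mulgV mul1g.
  by rewrite x0t tx mulgKV.
have [u0 Eu0] := qE p.
pose U := (linfun (fun u => (pt 1%g u)) @^-1: P)%VS.
have memU u : (u \in U) = ((pt 1%g u) \in P) by rewrite -memv_preim linfunE.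
have U1 : u0 \in U.
  by rewrite memU -(mulVg x0) -simpleDG_grpE; apply: Pg; rewrite -Eu0.
have Ufull : U = fullv.
  apply: (col_irreducible irr) => [c u cC|].
    by rewrite !memU -simpleDG_cent // mul1g -[in X in _ -> X](mulg1 c) -simpleDG_grpE; exact: Pg.
  apply: contraNneq q0 => U0; move: U1; rewrite U0 memv0 => /eqP u00.
  by rewrite Eu0 u00 (lin0 (uL _)).
apply/vspaceP => m; rewrite memvf; move: m; apply: simpleDG_ind => [a s s' sP tP||x u].
- by rewrite rpredD ?rpredZ.
- exact: mem0v.
by rewrite -(mulg1 x) -simpleDG_grpE; apply: Pg; rewrite -memU Ufull memvf.
Qed.

End SimpleDGTheory.

(** * Bosonizations *)

Section BosonTheory.
Variables (k : fieldType) (gT : finGroupType) (R : braidedHopf k gT).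
Local Notation kG := (grpalg k gT).
Local Notation act := (yd_act (bh_yd R)).
Local Notation coact := (yd_coact (bh_yd R)).
Local Notation "x # g" := (tens x (gelt g : grpalg k gT)) (at level 37).
Local Notation T := (tensor R kG).
Local Notation bmul := (@boson_mul k gT R).
Local Notation bcomul := (@boson_comul k gT R).
Local Notation banti := (@boson_anti k gT R).

Lemma lin_blift (X : lmodType k) (Z : vectType k) (f : R -> gT -> Z) (a : X -> T) :
  lin a -> lin (fun x => blift f (a x)).
Proof. exact: lin_tlift. Qed.

Lemma lin_blift_fun (X : lmodType k) (Z : vectType k) (f : X -> R -> gT -> Z) (a : T) :
  (forall x g, lin (fun u => f u x g)) -> lin (fun x => blift (f x) a).
Proof.
by move=> fL; apply: lin_tlift_fun => u w; apply: lin_glift_fun => g.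
Qed.

Lemma bliftE (Z : vectType k) (f : R -> gT -> Z) x g :
  (forall g, lin (f^~ g)) -> blift f (x # g) = f x g.
Proof.
move=> fL; rewrite /blift tlift_tens ?glift_gelt //; split=> u.
  exact: lin_glift lin_id.
exact: lin_glift_fun.
Qed.

Lemma boson_ind (P : T -> Prop) :
  (forall a s t, P s -> P t -> P (a *: s + t)) -> P 0 ->
  (forall x g, P (x # g)) -> forall t, P t.
Proof.
move=> PL P0 Px; apply: tens_ind => // x a.
rewrite [a]gelt_sum (lin_bigsum (f := fun a : kG => x ⊗ a)); last by lin_tac.
apply: (big_ind P) => // [s1 s2 P1 P2|i _].
  by rewrite -[s1]scale1r; exact: PL.
rewrite (linZ (f := fun a : kG => x ⊗ a)); last by lin_tac.
by rewrite -[_ *: _]addr0; exact: PL.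
Qed.

Lemma boson_ext (Z : lmodType k) (f h : T -> Z) :
  lin f -> lin h -> (forall x g, f (x # g) = h (x # g)) -> f =1 h.
Proof.
move=> fL hL fh; apply: boson_ind => // [a s t fs ft|].
  by rewrite fL hL fs ft.
by rewrite (lin0 fL) (lin0 hL).
Qed.

Lemma lin_boson_mul : bilin bmul.
Proof.
split=> x; rewrite /boson_mul; last exact: lin_blift lin_id.
by apply: lin_blift_fun => u g; apply: lin_blift lin_id.
Qed.

Lemma boson_mulE x g y h : bmul (x # g) (y # h) = (x * act g y) # (g * h)%g.
Proof.
by rewrite /boson_mul !bliftE // => ?; [lin_tac | apply: lin_blift_fun => ? ?; lin_tac].
Qed.

Lemma boson_ho_mulE x g y h :
  ho_mul (x # g : boson R) (y # h) = (x * act g y) # (g * h)%g.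
Proof. exact: boson_mulE. Qed.

Lemma lin_boson_comul : lin bcomul. Proof. exact: lin_blift lin_id. Qed.

Lemma boson_comulE x g : bcomul (x # g) =
  tlift (fun y z => \sum_h (y # (h * g)%g) ⊗ (coact h z # g)) (bh_comul R x).
Proof. by rewrite /boson_comul bliftE // => ?; lin_tac. Qed.

Lemma lin_boson_anti : lin banti. Proof. exact: lin_blift lin_id. Qed.

Lemma boson_antiE x g : banti (x # g) =
  \sum_h bmul (1 # (h * g)^-1%g) (bh_anti R (coact h x) # 1%g).
Proof.
rewrite /boson_anti bliftE // => h; apply: lin_sum => ?.
by apply: (lin_comp (lin_boson_mul.1 _)); lin_tac.
Qed.

Lemma boson_mulA : associative bmul.
Proof.
have [mr ml] := lin_boson_mul.
move=> a b c; move: a; apply: boson_ext => [||x g].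
- exact: ml.
- exact: lin_comp (ml c) (ml b).
move: b; apply: boson_ext => [||y h].
- exact: lin_comp (mr _) (ml c).
- exact: lin_comp (ml c) (mr _).
move: c; apply: boson_ext => [||z l].
- exact: lin_comp (mr _) (mr _).
- exact: mr.
by rewrite !boson_mulE bh_actM yd_actM mulrA mulgA.
Qed.

Lemma boson_counitE x g : ho_counit (x # g : boson R) = bh_counit R x.
Proof. by rewrite /= bliftE // => ?; lin_tac. Qed.

Lemma lin_boson_counit : lin (@ho_counit k (boson R) : boson R -> k^o).
Proof. exact: lin_blift lin_id. Qed.

Lemma tlift_boson_comul (Z : vectType k) (F : T -> T -> Z) x g : bilin F ->
  tlift F (bcomul (x # g)) =
  tlift (fun y z => \sum_h F (y # (h * g)%g) (coact h z # g)) (bh_comul R x).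
Proof.
move=> FL; rewrite boson_comulE (lin_tlift_comp (h := tlift F)); last by lin_tac.
apply: eq_tlift => y z; rewrite (lin_bigsum (f := tlift F)); last by lin_tac.
by apply: eq_bigr => h _; rewrite tlift_tens.
Qed.

(** Three facts combine: coassociativity in [R], compatibility of the coproduct of [R] with the
    coaction, and coassociativity of the coaction. *)
Lemma boson_coassoc a :
  tlift (fun a b => tlift (fun c d => c ⊗ d ⊗ b) (bcomul a)) (bcomul a)
    = tlift (fun a b => a ⊗ bcomul b) (bcomul a).
Proof.
have CL := lin_boson_comul.
move: a; apply: boson_ext => [||x g].
- exact: lin_comp (lin_tlift _ lin_id) CL.
- exact: lin_comp (lin_tlift _ lin_id) CL.
pose F (y z w : R) := \sum_h \sum_l
  (y # (l * (h * g))%g) ⊗ (coact l z # (h * g)%g) ⊗ (coact h w # g).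
have FL : trilin F by split=> ? ?; rewrite /F; lin_tac.
have assR := tlift_coassoc (@bh_coassoc _ _ R x) FL.
rewrite !tlift_boson_comul; first last.
- split=> ?; last by lin_tac; apply: lin_tlift => //; lin_tac.
  by lin_tac.
- split=> ?; first by lin_tac.
  by lin_tac.
under eq_tlift => y z do
  (under eq_bigr => h _ do (rewrite tlift_boson_comul; last by lin_tac)).
under eq_tlift => y z do rewrite -tlift_sum.
rewrite -assR; apply: eq_tlift => y z.
(* Here the coaction of degree [h] on [z] is distributed over its coproduct as [l'] and
   [l'^-1 * h]. *)
transitivity (tlift (fun z1 z2 => \sum_h \sum_l' \sum_l
   (y # (h * g)%g) ⊗ (coact l' z1 # (l * g)%g) ⊗ (coact l (coact (l'^-1 * h)%g z2) # g))
   (bh_comul R z)); last first.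
  rewrite tlift_sum; apply: eq_bigr => h _.
  pose G l z1 z2 : tensor T T := (z1 # (l * g)%g) ⊗ (coact l z2 # g).
  have GL l : bilin (G l) by rewrite /G; lin_tac.
  have sGL : lin (tlift (fun z1 z2 => \sum_l G l z1 z2)) by lin_tac.
  rewrite boson_comulE bh_comul_coact (lin_tlift_comp _ _ sGL).
  rewrite (lin_tlift_comp (h := tens _)); last by lin_tac.
  apply: eq_tlift => z1 z2; rewrite (lin_bigsum sGL).
  rewrite (lin_bigsum (f := tens _)); last by lin_tac.
  apply: eq_bigr => l' _; rewrite tlift_tens; last first.
    by split=> ?; apply: lin_sum => l; [exact: (GL l).1 | exact: (GL l).2].
  by rewrite (lin_bigsum (f := tens _)) //; lin_tac.
apply: eq_tlift => z1 z2; rewrite /F exchange_big [RHS]exchange_big /=.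
(* After the shift of [h] by [l], the repeated coaction on [z2] vanishes except on the diagonal. *)
apply: eq_bigr => l _; rewrite [RHS](reindex_inj (mulgI l)) /=.
apply: eq_bigr => h _; rewrite (bigD1 h) //= yd_coassoc mulKg eqxx big1 ?addr0.
  by rewrite mulgA.
move=> m /negbTE mh; rewrite yd_coassoc mh.
by rewrite !(lin0 (lin_tensl _ lin_id)) !(lin0 (lin_tensr _ lin_id)).
Qed.

(** Apply the counit to [S(x_(1)) x_(2) = eps(x) 1]; by multiplicativity the left side becomes
    [eps(S(x))]. *)
Lemma bh_counit_anti x : bh_counit R (bh_anti R x) = bh_counit R x.
Proof.
have := congr1 (bh_counit R) (@bh_antil _ _ R x).
rewrite linearZ /= bh_counit1 (lin_tlift_comp (h := bh_counit R)); last by lin_tac.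
move=> E; rewrite -[RHS]mulr1 -[RHS]E -[x in LHS](@bh_counitr _ _ R).
rewrite (lin_tlift_comp (h := fun x => bh_counit R (bh_anti R x))); last by lin_tac.
apply: eq_tlift => a b; rewrite bh_counitM !linearZ /=; exact: mulrC.
Qed.

Lemma bh_anti1 : bh_anti R 1 = 1.
Proof.
have := @bh_antil _ _ R 1; rewrite bh_comul1 tlift_tens ?bh_counit1 ?scale1r ?mulr1 //.
by lin_tac.
Qed.

Lemma boson_axioms : hopfAxioms (boson R).
Proof.
have [mr ml] := lin_boson_mul; have CL := lin_boson_comul.
have eL := lin_boson_counit; have SL := lin_boson_anti.
split=> //.
- exact: boson_mulA.
- apply: boson_ext => [||x g] //; first exact: (mr (1 # 1%g)).
  by rewrite [LHS]boson_mulE mul1r yd_act1 mul1g.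
- apply: boson_ext => [||x g] //; first exact: (ml (1 # 1%g)).
  by rewrite [LHS]boson_mulE bh_act1 mulr1 mulg1.
- exact: boson_coassoc.
- apply: boson_ext => [||x g] //; first by apply: (lin_comp _ CL); lin_tac.
  rewrite tlift_boson_comul; last by lin_tac; exact: lin_scaler.
  rewrite -[x in RHS](@bh_counitl _ _ R).
  rewrite (lin_tlift_comp (h := fun x => x # g)); last by lin_tac.
  apply: eq_tlift => y z; under eq_bigr do rewrite boson_counitE.
  rewrite -scaler_sumr -(lin_bigsum (f := fun z => z # g)); last by lin_tac.
  by rewrite yd_counit (linZ (f := fun z => z # g)) //; lin_tac.
- apply: boson_ext => [||x g] //; first by apply: (lin_comp _ CL); lin_tac.
  rewrite tlift_boson_comul; last by lin_tac; exact: lin_scaler.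
  rewrite -[x in RHS](@bh_counitr _ _ R).
  rewrite (lin_tlift_comp (h := fun x => x # g)); last by lin_tac.
  (* The counit kills the coaction components away from the identity of the group. *)
  apply: eq_tlift => y z; rewrite (bigD1 1%g) // big1.
    rewrite [LHS]addr0 boson_counitE bh_counit_coact eqxx mul1g.
    by rewrite (linZ (f := fun z => z # g)) //; lin_tac.
  by move=> h /andP[_ /negbTE h1]; rewrite boson_counitE bh_counit_coact h1 scale0r.
- move=> x y; suff E : (fun x : T => ho_counit (ho_mul (x : boson R) y) : k^o)
      =1 (fun x => (ho_counit (x : boson R) : k) * ho_counit y : k^o) by exact: E.
  move=> {x}; apply: boson_ext => [||x g].
  + exact: lin_comp eL (ml y).
  + exact: lin_mulk eL.
  move: y; apply: boson_ext => [||y h].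
  + exact: lin_comp eL (mr _).
  + exact: lin_kmul eL.
  by rewrite [ho_mul _ _]boson_mulE !boson_counitE bh_counitM bh_counit_act.
- suff E : (fun x : T => ho_counit (ho_anti (x : boson R)) : k^o)
      =1 (fun x => ho_counit (x : boson R) : k^o) by exact: E.
  apply: boson_ext => [||x g] //; first exact: lin_comp eL SL.
  rewrite [ho_anti _]boson_antiE (lin_bigsum eL) boson_counitE.
  under eq_bigr do rewrite boson_mulE boson_counitE bh_counitM bh_counit1 mul1r
    bh_counit_act bh_counit_anti.
  by rewrite -linear_sum yd_counit.
- rewrite [LHS]boson_comulE bh_comul1 tlift_tens; last by lin_tac.
  rewrite (bigD1 1%g) //= bh_coact1 eqxx mulg1 big1 ?addr0 // => h /negbTE h1.
  rewrite bh_coact1 h1.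
  by rewrite (lin0 (lin_tensl _ lin_id)) (lin0 (lin_tensr _ lin_id)).
- rewrite [LHS]boson_antiE (bigD1 1%g) //= bh_coact1 eqxx bh_anti1 boson_mulE.
  rewrite !mulg1 invg1 yd_act1 mulr1 big1 ?addr0 // => h /negbTE h1.
  by rewrite bh_coact1 h1 linear0 (lin0 (lin_tensl _ lin_id)) (lin0 (mr _)).
Qed.

Lemma boson_grouplike c : grouplike (1 # c : boson R) (1 # c^-1%g).
Proof.
have [mr ml] := lin_boson_mul; have CL := lin_boson_comul; have SL := lin_boson_anti.
have comulr d x : bcomul (bmul x (1 # d)) =
    tlift (fun a b => bmul a (1 # d) ⊗ bmul b (1 # d)) (bcomul x).
  move: x; apply: boson_ext => [||x g].
  - exact: lin_comp CL (ml _).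
  - by apply: (lin_comp _ CL); lin_tac.
  rewrite tlift_boson_comul; last first.
    by split=> ?; [apply: (lin_tensr _ (ml _)) | apply: (lin_tensl _ (ml _))].
  rewrite boson_mulE bh_act1 mulr1 boson_comulE; apply: eq_tlift => y z.
  by apply: eq_bigr => h _; rewrite !boson_mulE !bh_act1 !mulr1 mulgA.
split=> //.
- apply: boson_ext => [||x g].
  + exact: lin_comp CL (mr _).
  + by apply: (lin_comp _ CL); lin_tac.
  rewrite tlift_boson_comul; last first.
    by split=> ?; [apply: (lin_tensr _ (mr _)) | apply: (lin_tensl _ (mr _))].
  rewrite [ho_mul _ _]boson_mulE mul1r [LHS]boson_comulE bh_comul_act.
  rewrite (lin_tlift_comp (h := tlift _)); last by lin_tac.
  apply: eq_tlift => y z; rewrite tlift_tens; last by lin_tac.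
  (* Conjugating the summation index by [c] brings the coaction of [c . z] into the form of the
     Yetter-Drinfeld condition. *)
  rewrite (reindex_inj (inj_comp (mulIg c^-1%g) (mulgI c))) /=.
  apply: eq_bigr => h _; rewrite yd_compat !boson_mulE !mul1r.
  by rewrite -!mulgA mulKg.
- exact: comulr.
- exact: comulr.
- apply: boson_ext => [||x g].
  + exact: lin_comp SL (ml _).
  + exact: lin_comp (mr _) SL.
  rewrite [ho_mul _ _]boson_mulE bh_act1 mulr1 [LHS]boson_antiE [ho_anti _]boson_antiE.
  rewrite [RHS](lin_bigsum (mr _)); apply: eq_bigr => h _.
  by rewrite [RHS]boson_mulA (boson_mulE 1 c^-1) bh_act1 mulr1 -invMg mulgA.
Qed.

End BosonTheory.

(** * The grading of [B(V) # kG] and generation of its dual *)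

Section NicholsTheory.
Variables (k : fieldType) (gT : finGroupType).
Variables (V : vectType k) (ydV : ydStruct gT V) (B : nicholsAlgebra ydV).
Local Notation A := (boson B).
Local Notation kG := (grpalg k gT).
Local Notation D := (drinfeld (boson B)).
Local Notation act := (yd_act (bh_yd B)).
Local Notation coact := (yd_coact (bh_yd B)).
Local Notation "x # g" := (tens x (gelt g : grpalg k gT)) (at level 37).
Local Notation gr := (na_gr B).
Local Notation comp := (na_comp B).
Local Notation eps := (bh_counit B).
Local Notation Delta := (bh_comul B).
Let AX := boson_axioms B.

Lemma gr_comp n x : comp n x \in gr n. Proof. exact/memv_img/memvf. Qed.

Lemma comp_id n x : x \in gr n -> comp n x = x.
Proof. by case/memv_imgP=> y _ ->; rewrite na_comp_ortho eqxx. Qed.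

Lemma comp_neq m n x : x \in gr n -> m != n -> comp m x = 0.
Proof. by case/memv_imgP=> y _ -> /negbTE mn; rewrite na_comp_ortho mn. Qed.

Lemma one_gr0 : (1 : B) \in gr 0.
Proof. by have -> := na_gr0 B; exact: memv_line. Qed.

(** Degree 0 consists of the multiples of 1, and the counit, which vanishes in positive degrees,
    detects the multiple. *)
Lemma comp0 x : comp 0 x = (eps x : k) *: 1.
Proof.
have: comp 0 x \in gr 0 by exact: gr_comp.
have -> := na_gr0 B; case/vlineP => c E.
suff -> : eps x = c by [].
have [b /(_ x) sumx] := na_comp_sum B.
have -> : c = eps (comp 0 x) by rewrite E linearZ /= bh_counit1; exact/esym/mulr1.
rewrite -{1}sumx linear_sum; case: b {sumx} => [|b] in sumx *.
  by rewrite big_ord0 -sumx big_ord0 !linear0.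
rewrite big_ord_recl big1 ?addr0 // => i _.
exact: (na_gr_counit (gr_comp _ _)).
Qed.

(** The target [T] is left free: with [T] zero this proves that an expression vanishes, with [T] a
    graded piece it tracks degrees. *)
Lemma gr_comul_mem (Z : vectType k) (L : tensor B B -> Z) (T : {vspace Z}) n x :
  lin L -> x \in gr n ->
  (forall i j y z, (i + j = n)%N -> y \in gr i -> z \in gr j -> L (y ⊗ z) \in T) ->
  L (Delta x) \in T.
Proof.
move=> LL xn LT; have /memv_sumP[v vP ->] := na_gr_comul xn.
rewrite (lin_bigsum LL) memv_suml // => i _.
apply: (tensv_lin_mem LL) (vP i isT) => u w uP wP.
by apply: LT uP wP; rewrite subnKC // -ltnS.
Qed.

Definition Agr n : {vspace A} := tensv (gr n) {:kG}%VS.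

Lemma mem_Agr n x a : x \in gr n -> x ⊗ a \in Agr n.
Proof. by move=> xn; apply: memv_tens => //; exact: memvf. Qed.

Lemma Agr_lin_mem (Z : vectType k) (L : A -> Z) (T : {vspace Z}) n :
  lin L -> (forall x g, x \in gr n -> L (x # g) \in T) ->
  forall a, a \in Agr n -> L a \in T.
Proof.
move=> LL LT; apply: tensv_lin_mem => // x a xn _.
rewrite [a]gelt_sum (lin_bigsum (f := fun a : kG => x ⊗ a)); last by lin_tac.
rewrite (lin_bigsum LL) memv_suml // => g _.
by rewrite (linZ (f := fun a : kG => x ⊗ a)) ?(linZ LL) ?memvZ ?LT //; lin_tac.
Qed.

Lemma Agr_mul m n a b : a \in Agr m -> b \in Agr n -> ho_mul a b \in Agr (m + n).
Proof.
have [mr ml] := hx_mulL AX.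
move=> am bn; move: a am; apply: Agr_lin_mem => [|x g xm]; first exact: ml.
move: b bn; apply: Agr_lin_mem => [|y h yn]; first exact: mr.
rewrite [ho_mul _ _]boson_mulE; apply/mem_Agr/na_gr_mul => //.
exact: na_gr_act.
Qed.

Lemma Agr_anti n a : a \in Agr n -> ho_anti a \in Agr n.
Proof.
move: a; apply: Agr_lin_mem => [|x g xn]; first exact: hx_antiL.
rewrite [ho_anti _]boson_antiE memv_suml // => h _.
rewrite -[n]add0n; apply: Agr_mul; apply: mem_Agr; first exact: one_gr0.
by apply/na_gr_anti/na_gr_coact.
Qed.

Lemma Agr_comul_mem (Z : vectType k) (L : tensor A A -> Z) (T : {vspace Z}) n a :
  lin L -> a \in Agr n ->
  (forall i j b c, (i + j = n)%N -> b \in Agr i -> c \in Agr j -> L (b ⊗ c) \in T) ->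
  L (ho_comul a) \in T.
Proof.
move=> LL an LT; move: a an; apply: Agr_lin_mem => [|x g xn].
  exact: lin_comp LL (hx_comulL AX).
have bL : lin (fun t => L (tlift (fun y z => \sum_h (y # (h * g)%g) ⊗ (coact h z # g)) t)).
  by apply: (lin_comp LL); lin_tac.
rewrite [ho_comul _]boson_comulE; apply: (gr_comul_mem bL xn) => i j y z ijn yi zj.
rewrite tlift_tens; last by lin_tac.
rewrite (lin_bigsum LL) memv_suml // => h _; apply: LT ijn _ _; apply: mem_Agr => //.
exact: na_gr_coact.
Qed.

Lemma Agr_sw3_mem (Z : vectType k) (F : A -> A -> A -> Z) (T : {vspace Z}) n a :
  trilin F -> a \in Agr n ->
  (forall i j l b c d, (i + j + l = n)%N -> b \in Agr i -> c \in Agr j ->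
     d \in Agr l -> F b c d \in T) ->
  sw3 F a \in T.
Proof.
case=> Fc Fb Fa an FT; rewrite /sw3.
have cL := hx_comulL AX.
apply: (Agr_comul_mem (L := tlift (fun b c => tlift (F b) (ho_comul c)))) an _.
  by lin_tac.
move=> i j b c ijn bi cj; rewrite tlift_tens; last first.
  by split=> ?; [apply: (lin_tlift _ cL) | lin_tac; exact: Fa].
apply: (Agr_comul_mem (L := tlift (F b))) cj _; first by lin_tac.
move=> i' j' c' d' ij' ci dj; rewrite tlift_tens; last by split=> ?; [exact: Fc | exact: Fb].
by apply: (FT i i' j') => //; rewrite -addnA ij'.
Qed.

(** The functional [phi # epsilon]; this embeds the dual of B(V) into the dual of the
    bosonization. *)
Definition extd (phi : 'Hom(B, k^o)) : hdual A :=
  linfun (fun a : A => blift (fun x _ => phi x) a).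

Lemma extdE phi x g : extd phi (x # g) = phi x.
Proof.
by rewrite /extd linfunE; [rewrite bliftE // => ?; lin_tac | exact: lin_blift lin_id].
Qed.

Lemma hdual_ext (f f' : hdual A) : (forall x g, f (x # g) = f' (x # g)) -> f = f'.
Proof. by move=> ff'; apply/lfunP; apply: boson_ext => //; lin_tac. Qed.

Lemma lin_extd (X : lmodType k) (f : X -> 'Hom(B, k^o)) :
  lin f -> lin (fun x => extd (f x)).
Proof.
move=> fL a u v; apply: hdual_ext => x g.
by rewrite add_lfunE scale_lfunE !extdE fL add_lfunE scale_lfunE.
Qed.

Definition conv (phi psi : 'Hom(B, k^o)) : 'Hom(B, k^o) :=
  linfun (fun x => tlift (fun y z => phi y * psi z : k^o) (Delta x)).

Lemma convE phi psi x :
  conv phi psi x = tlift (fun y z => phi y * psi z : k^o) (Delta x).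
Proof. by rewrite /conv linfunE //; lin_tac. Qed.

(** Once the group components are ignored, the coaction in the coproduct of the bosonization sums to
    the identity. *)
Lemma extd_conv phi psi : dual_mul (extd phi) (extd psi) = extd (conv phi psi).
Proof.
apply: hdual_ext => x g; rewrite (dual_mulE AX) extdE convE.
rewrite tlift_boson_comul; last by split=> ?; [apply: lin_kmul|apply: lin_mulk]; lin_tac.
apply: eq_tlift => y z; under eq_bigr do rewrite !extdE.
by rewrite -mulr_sumr -linear_sum yd_counit.
Qed.

Lemma fun_of_kGE (f : hdual (groupHopf k gT)) x g :
  fun_of_kG B f (x # g) = eps x * f (gelt g).
Proof.
rewrite /fun_of_kG linfunE; last by apply: lin_lfun; exact: lin_blift lin_id.
rewrite /boson_proj bliftE ?linearZ // => h; apply: lin_scalel; lin_tac.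
Qed.

Lemma fun_of_dualVE y : fun_of_dualV B y = extd (y \o (na_emb B)^-1 \o comp 1)%VF.
Proof.
apply: hdual_ext => x g; rewrite extdE /fun_of_dualV linfunE; last exact: lin_blift lin_id.
by rewrite bliftE ?comp_lfunE // => ?; lin_tac.
Qed.

Lemma comul_bigraded n x : x \in gr n ->
  Delta x = \sum_(i < n.+1) tlift (fun y z => comp i y ⊗ comp (n - i)%N z) (Delta x).
Proof.
move=> xn; apply/eqP; rewrite -subr_eq0 -memv0.
apply: (gr_comul_mem (L := fun t => t - \sum_(i < n.+1)
  tlift (fun y z => comp i y ⊗ comp (n - i)%N z) t) _ xn); first by lin_tac.
move=> i j y z ijn yi zj; have iN : (i < n.+1)%N by rewrite ltnS -ijn leq_addr.
rewrite memv0 (bigD1 (Ordinal iN)) //= big1 => [|l nl].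
  rewrite tlift_tens; last by lin_tac.
  by rewrite -ijn addKn !comp_id // addr0 subrr.
rewrite tlift_tens; last by lin_tac.
by rewrite (comp_neq yi) // (lin0 (lin_tensl _ lin_id)).
Qed.

Lemma conv_comp_gr phi psi i j m x : x \in gr m -> (i + j)%N != m ->
  conv (phi \o comp i)%VF (psi \o comp j)%VF x = 0.
Proof.
move=> xm ijm; apply/eqP; rewrite convE -memv0.
apply: (gr_comul_mem (L := tlift _) _ xm) => [|i' j' y z ijm' yi zj]; first by lin_tac.
rewrite memv0 tlift_tens; last by split=> ?; [apply: lin_kmul|apply: lin_mulk]; lin_tac.
rewrite !comp_lfunE; have [ii | ii] := eqVneq i i'; last first.
  by rewrite (comp_neq yi) // linear0 mul0r.
rewrite [comp j z](comp_neq zj) ?linear0 ?mulr0 //.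
by apply: contraNneq ijm => jj; rewrite ii jj ijm'.
Qed.

(** Functionals supported in degrees [i] and [j] have a convolution supported in degree [i + j], as
    the coproduct is graded. *)
Lemma conv_comp phi psi i j :
  (conv (phi \o comp i) (psi \o comp j) \o comp (i + j))%VF
    = conv (phi \o comp i)%VF (psi \o comp j)%VF.
Proof.
apply/lfunP => x; rewrite comp_lfunE; have [b /(_ x) sumx] := na_comp_sum B.
rewrite -[in RHS]sumx linear_sum; have [ijb | bij] := ltnP (i + j)%N b.
  rewrite (bigD1 (Ordinal ijb)) //= big1 ?addr0 // => l nl.
  by rewrite (conv_comp_gr _ _ (gr_comp l x)) // eq_sym.
have -> : comp (i + j)%N x = 0.
  rewrite -[in LHS]sumx linear_sum big1 // => l _ /=.
  rewrite (comp_neq (gr_comp l x)) //.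
  by apply: contraTneq bij => ->; rewrite -ltnNge.
rewrite linear0 big1 // => l _ /=; rewrite (conv_comp_gr _ _ (gr_comp l x)) //.
by apply: contraTneq bij => ->; rewrite -ltnNge.
Qed.

(** * Generation of the dual by functionals of degrees 0 and 1 *)

Section Generation.
Variable Q : {vspace hdual A}.
Hypothesis Q1 : dual_one A \in Q.
Hypothesis QM : forall p q, p \in Q -> q \in Q -> dual_mul p q \in Q.
Hypothesis QkG : forall f, fun_of_kG B f \in Q.
Hypothesis QV : forall y, fun_of_dualV B y \in Q.

(* Annihilating all products of functionals of lower degrees means being
   primitive, and primitive elements have degree 1. *)
Lemma extd_comp_mem n phi : extd (phi \o comp n)%VF \in Q.
Proof.
have [m] := ubnP n; elim: m n phi => // m IH [|[|n]] phi nm.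
- suff -> : extd (phi \o comp 0)%VF = (phi 1 : k) *: dual_one A by rewrite memvZ.
  apply: hdual_ext => x g; rewrite extdE comp_lfunE comp0 linearZ scale_lfunE.
  by rewrite (dual_oneE AX) boson_counitE; exact: mulrC.
- suff -> : extd (phi \o comp 1)%VF = fun_of_dualV B (phi \o na_emb B)%VF by [].
  rewrite fun_of_dualVE; congr extd; apply/lfunP => x; rewrite !comp_lfunE.
  by rewrite limg_lfunVK // na_emb_img gr_comp.
have FL : lin (fun phi : 'Hom(B, k^o) => extd (phi \o comp n.+2)%VF).
  by apply: lin_extd => a u v; rewrite comp_lfunDl comp_lfunZl.
(* By duality it suffices that an [x] killed by all of [Qn] is zero, where [Qn] collects the
   functionals whose part of degree [n.+2] is in [Q]. *)
pose Qn := (linfun (fun phi : 'Hom(B, k^o) => extd (phi \o comp n.+2)%VF) @^-1: Q)%VS.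
have memQn psi : (psi \in Qn) = (extd (psi \o comp n.+2)%VF \in Q).
  by rewrite -memv_preim linfunE.
rewrite -memQn; suff -> : Qn = fullv by exact: memvf.
apply: annihilator_sep => x Qx.
(* Functionals with zero part in degree [n.+2] belong to [Qn], so they kill [x], which is therefore
   homogeneous. *)
have xn : comp n.+2 x = x.
  apply/eqP; rewrite eq_sym -subr_eq0; apply/eqP/coord_sep => psi.
  have : (psi - (psi \o comp n.+2))%VF \in Qn.
    rewrite memQn; suff -> : ((psi - (psi \o comp n.+2)) \o comp n.+2)%VF = 0.
      by rewrite (lin0 (lin_extd lin_id)) mem0v.
    apply/lfunP => y; rewrite comp_lfunE add_lfunE opp_lfunE comp_lfunE.
    by rewrite na_comp_ortho eqxx subrr zero_lfunE.
  by move/Qx; rewrite add_lfunE opp_lfunE comp_lfunE linearB.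
have xgr : x \in gr n.+2 by rewrite -xn gr_comp.
(* The degrees [i.+1] and [n.+1 - i] are positive and add up to [n.+2], so both are smaller than
   [n.+2] and products of such functionals lie in [Q] by induction. Products of functionals separate
   tensors. *)
have mid i : (i < n.+1)%N ->
    tlift (fun y z => comp i.+1 y ⊗ comp (n.+1 - i)%N z) (Delta x) = 0.
  move=> ni; apply: tens_sep => phi1 phi2.
  rewrite (lin_tlift_comp (h := tlift _)); last by lin_tac.
  have cQ : conv (phi1 \o comp i.+1)%VF (phi2 \o comp (n.+1 - i)%N)%VF \in Qn.
    rewrite memQn; have -> : n.+2 = (i.+1 + (n.+1 - i))%N.
      by rewrite addSn subnKC // ltnW.
    rewrite conv_comp -extd_conv; apply: QM; apply: IH.
      by apply: leq_trans (_ : i.+2 <= n.+2)%N _.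
    by apply: leq_trans (_ : n.+2 <= m)%N; rewrite ?ltnS ?leq_subr.
  rewrite -(Qx _ cQ) convE; apply: eq_tlift => y z.
  by rewrite tlift_tens ?comp_lfunE // ; split=> ?; [apply: lin_kmul|apply: lin_mulk]; lin_tac.
(* Only the two extreme components of the coproduct are left, and the counit axioms identify them as
   [x ⊗ 1] and [1 ⊗ x]. *)
have : x \in gr 1.
  apply/na_prim; rewrite (comul_bigraded xgr) big_ord_recl big_ord_recr /=.
  rewrite big1 ?add0r => [|i _]; last exact: mid.
  rewrite subn0 subnn addrC; congr (_ + _).
    rewrite -[in RHS]xn -[x in RHS](@bh_counitr _ _ B).
    rewrite (lin_tlift_comp (h := fun x => comp n.+2 x ⊗ 1)); last by lin_tac.
    apply: eq_tlift => y z; rewrite comp0 linearZ /=.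
    rewrite (linZ (f := fun x => comp n.+2 y ⊗ x)); last by lin_tac.
    by rewrite (linZ (f := fun x : B => x ⊗ (1 : B))) //; lin_tac.
  rewrite -[in RHS]xn -[x in RHS](@bh_counitl _ _ B).
  rewrite (lin_tlift_comp (h := fun x => 1 ⊗ comp n.+2 x)); last by lin_tac.
  apply: eq_tlift => y z; rewrite comp0 linearZ /=.
  rewrite (linZ (f := fun x => x ⊗ comp n.+2 z)); last by lin_tac.
  by rewrite (linZ (f := fun x : B => (1 : B) ⊗ x)) //; lin_tac.
by move=> x1; rewrite -xn (comp_neq x1).
Qed.

Lemma extd_mem phi : extd phi \in Q.
Proof.
have [b sumx] := na_comp_sum B.
suff -> : phi = \sum_(n < b) (phi \o comp n)%VF.
  rewrite (lin_bigsum (lin_extd lin_id)) memv_suml // => n _.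
  exact: extd_comp_mem.
apply/lfunP => x; rewrite sum_lfunE -[in LHS](sumx x) linear_sum.
by apply: eq_bigr => n _; rewrite comp_lfunE.
Qed.

(** Any functional is the sum over [h] of its slice [x |-> f (x # h)], extended by [extd], times the
    delta function at [h]. *)
Lemma generation_full : Q = fullv.
Proof.
apply/vspaceP => f; rewrite memvf.
pose dl h : hdual (groupHopf k gT) := linfun (fun a : kG => a h).
have dlE h z : dl h (gelt z) = (h == z)%:R.
  by rewrite linfunE ?ffunE // => c u v; rewrite !ffunE.
pose fh h : 'Hom(B, k^o) := linfun (fun x => f (x # h)).
have fhE h x : fh h x = f (x # h) by rewrite linfunE //; lin_tac.
suff -> : f = \sum_h dual_mul (extd (fh h)) (fun_of_kG B (dl h)).
  by rewrite memv_suml // => h _; apply: QM => //; exact: extd_mem.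
apply: hdual_ext => x g; rewrite sum_lfunE.
have E h : dual_mul (extd (fh h)) (fun_of_kG B (dl h)) (x # g) = f (x # h) * (h == g)%:R.
  rewrite (dual_mulE AX) tlift_boson_comul; last first.
    by split=> ?; [apply: lin_kmul|apply: lin_mulk]; lin_tac.
  rewrite -fhE -[x in RHS](@bh_counitr _ _ B).
  rewrite (lin_tlift_comp (h := fun x => fh h x * (h == g)%:R : k^o)); last first.
    by apply: lin_mulk; lin_tac.
  apply: eq_tlift => y z; under eq_bigr do rewrite extdE fun_of_kGE dlE.
  rewrite -mulr_sumr -mulr_suml -linear_sum yd_counit linearZ /=.
  by rewrite mulrCA mulrA.
rewrite (bigD1 g) //= E eqxx mulr1 big1 ?addr0 // => h /negbTE hg.
by rewrite E hg mulr0.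
Qed.

End Generation.

(** * Generators of the nonnegative part of the double *)

Local Notation Dgen := (Dgroup B + Dfun B + Dbar B)%VS.

Lemma Dgroup_mem h : (1 # h : A) ⊗ dual_one A \in Dgen.
Proof.
apply: (subvP (subv_trans (addvSl _ _) (addvSl _ _))).
by apply/memv_span/mapP; exists h; rewrite ?mem_enum.
Qed.

Lemma span_map_mem (U W : vectType k) (f : U -> W) u :
  lin f -> f u \in <<[seq f v | v <- vbasis {:U}]>>%VS.
Proof.
move=> fL; rewrite [u]coord_vbasis_sum (lin_bigsum fL) memv_suml // => i _.
rewrite (linZ fL) memvZ // memv_span // map_f //.
by rewrite mem_nth // size_tuple.
Qed.

Lemma Dfun_mem f : ho_one A ⊗ fun_of_kG B f \in Dgen.
Proof.
apply: (subvP (subv_trans (addvSr _ _) (addvSl _ _))).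
apply: (span_map_mem (f := fun f => ho_one A ⊗ fun_of_kG B f)).
apply: lin_tensr => a u v; apply: hdual_ext => x g.
by rewrite add_lfunE scale_lfunE !fun_of_kGE add_lfunE scale_lfunE mulrDr mulrCA.
Qed.

Lemma Dbar_mem y : ho_one A ⊗ fun_of_dualV B y \in Dgen.
Proof.
apply: (subvP (addvSr _ _)).
apply: (span_map_mem (f := fun y => ho_one A ⊗ fun_of_dualV B y)).
apply: lin_tensr => a u v; rewrite !fun_of_dualVE.
rewrite -(lin_extd lin_id); congr extd.
by rewrite !comp_lfunDl !comp_lfunZl.
Qed.

(** The generators from k^G and from V^* are treated alike, as instances of [ho_one A ⊗ f]. *)
Lemma Dgen_ind (P : D -> Prop) :
  (forall a s t, P s -> P t -> P (a *: s + t)) -> P 0 ->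
  (forall h, P ((1 # h : A) ⊗ dual_one A)) -> (forall f, P (ho_one A ⊗ f)) ->
  forall x, x \in Dgen -> P x.
Proof.
move=> PL P0 Pg Pf x.
have sp (L : seq D) : (forall y, y \in L -> P y) -> forall y, y \in <<L>>%VS -> P y.
  move=> rL y yL; rewrite (@coord_span _ _ _ (in_tuple L) y yL).
  apply: (big_ind P) => // [s t Ps Pt|i _].
    by rewrite -[s]scale1r; exact: PL.
  by rewrite -[_ *: _]addr0; apply: PL => //; apply: rL; rewrite mem_nth.
have add (y z : D) : P y -> P z -> P (y + z).
  by move=> ry rz; rewrite -[y]scale1r; exact: PL.
case/memv_addP=> _ /memv_addP[y yG [z zF ->]] [w wV ->].
have Py : P y by move: y yG; apply: sp => _ /mapP[h _ ->]; exact: Pg.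
have Pz : P z by move: z zF; apply: sp => _ /mapP[h _ ->].
have Pw : P w by move: w wV; apply: sp => _ /mapP[h _ ->].
exact: (add _ _ (add _ _ Py Pz) Pw).
Qed.

Lemma Dgen_rassoc x : x \in Dgen -> rassoc x.
Proof.
apply: Dgen_ind => [a s t|||]; [exact: rassoc_lin | exact: rassoc0 | | ].
- by move=> h; exact: (rassoc_grouplike AX (boson_grouplike B h)).
- by move=> f; exact: rassoc_dual.
Qed.

Lemma Dge0_rassoc s : s \in Dge0 B -> rassoc s.
Proof. exact: double_gen_rassoc AX _ Dgen_rassoc s. Qed.

(** Left multiplication by a generator [1 ⊗ p] is right multiplication by [p] on functionals. So one
    works with the right multipliers of [E] instead of [E]: they form a subalgebra containing the
    generating functionals, hence are everything, and applied to the counit in [E] they give the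
    claim for [1 ⊗ f]. The factor [1 # h] is one more left multiplication. *)
Lemma Dge0_mem h f : (1 # h : A) ⊗ f \in Dge0 B.
Proof.
suff f1 : ho_one A ⊗ f \in Dge0 B.
  rewrite -[1 # h](hx_mulh1 AX) -(double_mull AX).
  by apply: double_gen_mul => //; exact: Dgroup_mem.
have tL : lin (fun f : hdual A => ho_one A ⊗ f) by lin_tac.
pose E := (linfun (fun f : hdual A => ho_one A ⊗ f) @^-1: Dge0 B)%VS.
have memE p : (p \in E) = (ho_one A ⊗ p \in Dge0 B) by rewrite -memv_preim linfunE.
(* Testing multipliers on a basis of [E] exhibits them as a finite intersection of subspaces. *)
pose Q := (\bigcap_(i < \dim E) (linfun (dual_mul (vbasis E)`_i) @^-1: E))%VS.
have mL p : lin (dual_mul (p : hdual A)) by exact: (lin_dmulr AX p lin_id).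
have memQ p : reflect (forall e, e \in E -> dual_mul e p \in E) (p \in Q).
  apply: (iffP idP) => [pQ e eE|pE].
    rewrite (coord_vbasis eE) (lin_bigsum (lin_dmull AX p lin_id)) memv_suml // => i _.
    rewrite (linZ (lin_dmull AX p lin_id)) memvZ //.
    have : p \in (linfun (dual_mul (vbasis E)`_i) @^-1: E)%VS.
      by apply: (subvP (bigcapv_inf i _ (subvv _))) pQ.
    by rewrite -memv_preim linfunE.
  rewrite /Q memvE; apply/subv_bigcapP => i _; rewrite -memvE -memv_preim linfunE //.
  by apply: pE; apply: vbasis_mem; rewrite mem_nth ?size_tuple.
have E1 : dual_one A \in E by rewrite memE; exact: double_gen_one.
have stepE p : ho_one A ⊗ p \in Dgen -> p \in Q.
  move=> pX; apply/memQ => e; rewrite !memE => eE.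
  by rewrite -(double_mulr_dual AX); exact: double_gen_mul.
suff Qf : Q = fullv.
  by rewrite -memE -[f](dual_1mul AX); apply: (memQ _ _) E1; rewrite Qf memvf.
apply: generation_full.
- by apply/memQ => e eE; rewrite (dual_mul1 AX).
- move=> p q /memQ pQ /memQ qQ; apply/memQ => e eE.
  by rewrite (dual_mulA AX); apply/qQ/pQ.
- by move=> p; apply/stepE/Dfun_mem.
- by move=> y; apply/stepE/Dbar_mem.
Qed.

End NicholsTheory.

(** * Graded modules generated in top degree *)

Section GradedModule.
Variables (k : fieldType) (W : vectType k) (D : Type) (T : D -> W -> W).
Variables (cp : nat -> 'End(W)) (b : nat).

Definition stable (N : {vspace W}) := forall d w, w \in N -> T d w \in N.

(* In terms of the depth, the negative of the degree: [T d] is zero in depth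
   [< q] and raises the depth by [p - q] otherwise. *)
Definition homop p q d := forall n w,
  T d (cp n w) = if (q <= n)%N then cp (p + (n - q))%N (T d (cp n w)) else 0.

Hypothesis T_lin : forall d, lin (T d).
Hypothesis cp_ortho : forall m n w, cp m (cp n w) = if m == n then cp n w else 0.
Hypothesis cp_sum : forall w, \sum_(n < b) cp n w = w.

Lemma cp_big n w : (b <= n)%N -> cp n w = 0.
Proof.
move=> bn; rewrite -[w]cp_sum linear_sum big1 // => i _ /=.
rewrite cp_ortho; case: eqP => // ni; have := ltn_ord i.
by rewrite -ni ltnNge bn.
Qed.

(** Different depths have different images under a shift, so the component of [T d w] in the shifted
    depth comes from depth [n] alone. *)
Lemma homop_cp p q d n w :
  homop p q d -> (q <= n)%N -> cp (p + (n - q))%N (T d w) = T d (cp n w).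
Proof.
move=> hd qn; rewrite -[w in LHS]cp_sum (lin_bigsum (T_lin d)) linear_sum /=.
have other l : l != n -> cp (p + (n - q))%N (T d (cp l w)) = 0.
  move=> ln; rewrite hd; case: ifP => [ql|_]; last exact: linear0.
  rewrite cp_ortho eqn_add2l -(eqn_add2r q) !subnK // eq_sym (negbTE ln).
  by [].
have [nb | bn] := ltnP n b; last first.
  rewrite [cp n w]cp_big // (lin0 (T_lin d)) big1 // => i _.
  by apply: other; apply: contraTneq bn => <-; rewrite -ltnNge.
rewrite (bigD1 (Ordinal nb)) //= big1 ?addr0 => [|i ne]; last exact: other.
by rewrite [RHS]hd qn.
Qed.

(** This expresses that every operator is a combination of homogeneous ones, without giving [D] a
    linear structure. *)
Hypothesis homop_stable : forall N : {vspace W},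
  (forall p q d, homop p q d -> forall w, w \in N -> T d w \in N) -> stable N.
Hypothesis top_generates : forall N : {vspace W},
  stable N -> ~~ (N <= lker (cp 0))%VS -> N = fullv.
Hypothesis top_neq0 : exists w, cp 0 w != 0.

(** A stable subspace of [K] of maximal dimension contains all others, because sums of stable
    subspaces are stable. It is found by induction on a bound for the codimension, with excluded
    middle since stability quantifies over all operators. *)
Lemma ex_largest_stable (K : {vspace W}) : exists N : {vspace W},
  [/\ stable N, (N <= K)%VS
    & forall N' : {vspace W}, stable N' -> (N' <= K)%VS -> (N' <= N)%VS].
Proof.
suff H m (N : {vspace W}) : stable N -> (N <= K)%VS -> (\dim {:W} - \dim N <= m)%N ->
    exists N0 : {vspace W}, [/\ stable N0, (N0 <= K)%VS
      & forall N' : {vspace W}, stable N' -> (N' <= K)%VS -> (\dim N' <= \dim N0)%N].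
  have s0 : stable 0%VS.
    by move=> d w; rewrite !memv0 => /eqP ->; rewrite (lin0 (T_lin d)).
  have [N [sN NK Nmax]] := H _ _ s0 (sub0v _) (leqnn _).
  exists N; split=> // N' sN' N'K.
  have sNN : stable (N + N')%VS.
    move=> d _ /memv_addP[u uN [v vN ->]].
    by rewrite (linD (T_lin d)) memv_add ?sN ?sN'.
  have := Nmax _ sNN; rewrite subv_add NK N'K => /(_ isT) dimNN.
  have /eqP-> : N == (N + N')%VS by rewrite eqEdim addvSl.
  exact: addvSr.
elim: m N => [|m IH] N sN NK Nm.
  exists N; split=> // N' _ _; rewrite leqn0 subn_eq0 in Nm.
  by apply: leq_trans Nm; rewrite dimvS ?subvf.
have [[N' [sN' N'K NN']]|nex] := classic (exists N' : {vspace W},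
    [/\ stable N', (N' <= K)%VS & (\dim N < \dim N')%N]).
  apply: (IH N') => //; rewrite -ltnS; apply: leq_trans Nm.
  by rewrite ltn_sub2l // (leq_trans NN') // dimvS ?subvf.
exists N; split=> // N' sN' N'K; rewrite leqNgt; apply/negP => NN'.
by apply: nex; exists N'.
Qed.

Lemma graded_unique_maximal : exists N : {vspace W},
  [/\ [/\ stable N, N <> fullv & forall N' : {vspace W}, stable N' ->
          (N <= N')%VS -> N' = N \/ N' = fullv],
      forall N' : {vspace W}, [/\ stable N', N' <> fullv
        & forall N'' : {vspace W}, stable N'' ->
          (N' <= N'')%VS -> N'' = N' \/ N'' = fullv] -> N' = N
    & forall n w, w \in N -> cp n w \in N].
Proof.
have [N [sN NK Nmax]] := ex_largest_stable (lker (cp 0)).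
have proper N' : stable N' -> N' <> fullv -> (N' <= N)%VS.
  move=> sN' nf; apply: Nmax => //; apply/negPn/negP => /(top_generates sN').
  exact: nf.
have nfull : N <> fullv.
  have [w w0] := top_neq0; move=> Nf; case/negP: w0.
  by rewrite -memv_ker; apply: (subvP NK); rewrite Nf memvf.
exists N; split.
- split=> // N' sN' NN'; have [->|nf] := eqVneq N' fullv; first by right.
  left; apply/eqP; rewrite eqEsubv NN' andbT; apply: proper => //; exact/eqP.
- move=> N' [sN' nf max']; have N'N := proper _ sN' nf.
  by case: (max' _ sN N'N).
(* The span of the components of [N] is stable and has no part in depth 0, so by maximality it lies
   in [N]. *)
pose G := (\sum_(n < b) (cp n @: N))%VS.
have memG n w : w \in N -> cp n w \in G.
  move=> wN; have [nb | bn] := ltnP n b; last by rewrite cp_big // mem0v.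
  by apply: (subvP (sumv_sup (Ordinal nb) _ (subvv _))) => //; exact: memv_img.
have sG : stable G.
  apply: homop_stable => p q d hd w /memv_sumP[v vG ->].
  rewrite (lin_bigsum (T_lin d)) memv_suml // => n _.
  have [u uN ->] := memv_imgP (vG n isT).
  have [qn | nq] := leqP q n; last by rewrite hd leqNgt nq mem0v.
  by rewrite -(homop_cp _ hd qn) memG // sN.
have GK : (G <= lker (cp 0))%VS.
  apply/subv_sumP => n _; apply/subvP => w /memv_imgP[u uN ->].
  rewrite memv_ker cp_ortho; have [<-|_] := eqVneq 0%N n; last by [].
  by rewrite -memv_ker (subvP NK).
by move=> n w wN; apply: (subvP (Nmax _ sG GK)); exact: memG.
Qed.

End GradedModule.

(** * Verma modules *)

Section VermaTheory.
Variables (k : fieldType) (gT : finGroupType).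
Variables (V : vectType k) (ydV : ydStruct gT V) (B : nicholsAlgebra ydV).
Variables (g : gT) (n : nat) (rho : mx_representation k 'C[g]%g n).
Local Notation A := (boson B).
Local Notation kG := (grpalg k gT).
Local Notation D := (drinfeld (boson B)).
Local Notation "x # g" := (tens x (gelt g : grpalg k gT)) (at level 37).
Local Notation gr := (na_gr B).
Local Notation comp := (na_comp B).
Local Notation eps := (bh_counit B).
Local Notation M := (simpleDG rho).
Local Notation dact := (@Dge0_act k gT V ydV B g n rho).
Local Notation dmul := (@double_mul k A).
Local Notation proj := (ind_proj dmul (Dge0 B) dact).
Let AX := boson_axioms B.

Definition restr (f : hdual A) : hdual (groupHopf k gT) :=
  linfun (fun c : kG => f (boson_incl B c)).

Lemma restrE f z : restr f (gelt z) = f (1 # z).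
Proof. by rewrite /restr linfunE //; rewrite /boson_incl; lin_tac. Qed.

Lemma lin_restr (X : lmodType k) (f : X -> hdual A) :
  lin f -> lin (fun x => restr (f x)).
Proof.
by move=> fL; apply: lin_linfun => ?; rewrite /boson_incl; lin_tac.
Qed.

(* The coordinates of [d (x) m] in [B(V) (x) M]. *)
Definition theta (d : D) (m : M) : tensor B M :=
  tlift (fun (a : A) (f : hdual A) =>
    blift (fun x h => x ⊗ simpleDG_grp h (simpleDG_fun (restr f) m)) a) d.

Lemma lin_simpleDG_grpr (X : lmodType k) h (f : X -> M) : lin f -> lin (fun x => simpleDG_grp h (f x)).
Proof. exact: (lin_comp (lin_simpleDG_grp _)). Qed.

Lemma lin_simpleDG_funr (X : lmodType k) p (f : X -> M) :
  lin f -> lin (fun x => simpleDG_fun p (f x)).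
Proof. exact: (lin_comp (lin_simpleDG_fun _)). Qed.

Lemma thetaE x h f m :
  theta ((x # h : A) ⊗ f) m = x ⊗ simpleDG_grp h (simpleDG_fun (restr f) m).
Proof.
rewrite /theta tlift_tens ?bliftE // => [?|]; first by lin_tac.
split=> ?; last exact: lin_blift lin_id.
apply: lin_blift_fun => ? ?; apply/lin_tensr/lin_simpleDG_grpr/lin_simpleDG_funl.
exact: lin_restr lin_id.
Qed.

Lemma lin_theta : bilin theta.
Proof.
split=> ?; last exact: lin_tlift lin_id.
apply: lin_tlift_fun => ? ?; apply: lin_blift_fun => ? ?.
exact/lin_tensr/lin_simpleDG_grpr/lin_simpleDG_funr/lin_id.
Qed.

Lemma D_ext (Z : lmodType k) (F G : D -> Z) : lin F -> lin G ->
  (forall x h f, F ((x # h : A) ⊗ f) = G ((x # h : A) ⊗ f)) -> F =1 G.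
Proof.
move=> FL GL FG; apply: tens_ext => // a f; move: a; apply: boson_ext => [||x h].
- by apply: (lin_comp FL); lin_tac.
- by apply: (lin_comp GL); lin_tac.
- exact: FG.
Qed.

Definition evM (t : tensor B M) : M := tlift (fun x m => (eps x : k) *: m) t.

Lemma evME x m : evM (x ⊗ m) = (eps x : k) *: m.
Proof. by rewrite /evM tlift_tens //; lin_tac; exact: lin_scaler. Qed.

Lemma lin_evM : lin evM. Proof. exact: lin_tlift lin_id. Qed.

Lemma lin_double_proj : lin (@double_proj k gT B). Proof. exact: lin_tlift lin_id. Qed.

(** The counit of B(V) projects [B (x) M] onto its top part, and the action on [M] is this
    projection of [theta]. Properties of the action can thus be read off [theta]. *)
Lemma dact_theta d m : dact d m = evM (theta d m).
Proof.
have actL : lin (fun d => simpleDG_act d m : M) by exact: lin_tlift lin_id.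
apply: (D_ext (F := fun d => dact d m) (G := fun d => evM (theta d m))) d => [||x h f].
- exact: lin_comp actL lin_double_proj.
- exact: lin_comp lin_evM (lin_theta.2 _).
rewrite thetaE evME /Dge0_act /double_proj tlift_tens; last first.
  split=> ?; first by apply: lin_tensr; apply: lin_restr lin_id.
  by apply: lin_tensl; exact: lin_blift lin_id.
rewrite -/(restr f) simpleDG_actE /boson_proj bliftE; last by move=> ?; lin_tac.
rewrite (linZ (f := glift _)); last exact: lin_glift lin_id.
by rewrite glift_gelt.
Qed.

Lemma dactE x h f m :
  dact ((x # h : A) ⊗ f) m = (eps x : k) *: simpleDG_grp h (simpleDG_fun (restr f) m).
Proof. by rewrite dact_theta thetaE evME. Qed.

Lemma lin_dact : bilin dact.
Proof.
split=> x a u v; rewrite !dact_theta.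
  by rewrite (lin_theta.1 _) lin_evM.
by rewrite (lin_theta.2 _) lin_evM.
Qed.

Lemma restr_dual_one m : simpleDG_fun (restr (dual_one A)) m = m :> M.
Proof.
apply: simpleDG_fun1 => z; rewrite restrE (dual_oneE AX) boson_counitE.
exact: bh_counit1.
Qed.

Lemma dact1 m : dact (double_one A) m = m.
Proof. by rewrite [dact _ _]dactE bh_counit1 scale1r simpleDG_grp1 restr_dual_one. Qed.

Lemma dact_dual f m : dact (ho_one A ⊗ f) m = simpleDG_fun (restr f) m.
Proof. by rewrite [dact _ _]dactE bh_counit1 scale1r simpleDG_grp1. Qed.

(** The product of functionals is reversed in the double, but restricted to [kG] it is pointwise
    multiplication and commutes. *)
Lemma theta_dual d f m : theta (dmul d (ho_one A ⊗ f)) m = theta d (dact (ho_one A ⊗ f) m).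
Proof.
apply: (D_ext (F := fun d => theta (dmul d (ho_one A ⊗ f)) m)
  (G := fun d => theta d (dact (ho_one A ⊗ f) m))) d => [||x h p].
- exact: lin_comp (lin_theta.2 m) ((@double_mul_lin k A).2 _).
- exact: lin_theta.2.
rewrite (double_mulr_dual AX) !thetaE dact_dual; congr (_ ⊗ simpleDG_grp _ _).
apply: simpleDG_funM => z; rewrite !restrE (dual_mulE AX).
rewrite [ho_comul _](comul_grouplike AX (boson_grouplike B z)) tlift_tens; last first.
  by split=> ?; [apply: lin_kmul | apply: lin_mulk]; lin_tac.
exact: mulrC.
Qed.

Lemma theta_grouplike d c m :
  theta (dmul d ((1 # c : A) ⊗ dual_one A)) m = theta d (dact ((1 # c : A) ⊗ dual_one A) m).
Proof.
apply: (D_ext (F := fun d => theta (dmul d ((1 # c : A) ⊗ dual_one A)) m)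
  (G := fun d => theta d (dact ((1 # c : A) ⊗ dual_one A) m))) d => [||x h p].
- exact: lin_comp (lin_theta.2 m) ((@double_mul_lin k A).2 _).
- exact: lin_theta.2.
rewrite (double_mulr_grouplike AX (boson_grouplike B c)) boson_ho_mulE.
rewrite bh_act1 mulr1 !thetaE dactE bh_counit1 scale1r restr_dual_one simpleDG_grpM.
congr (_ ⊗ simpleDG_grp _ _); apply/esym/simpleDG_fun_simpleDG_grp => z.
rewrite !restrE (conjdE AX) !boson_ho_mulE.
by rewrite !(bh_act1, mulr1) mulgA.
Qed.

(** The balancing condition for [Theta]. [rassoc s] is carried along the induction, to rewrite
    [d (x s)] as [(d x) s]. *)
Lemma theta_Dge0 s : s \in Dge0 B ->
  forall d m, theta (dmul d s) m = theta d (dact s m).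
Proof.
have tl := lin_theta.2; have tr := lin_theta.1.
have [ml mr] := @double_mul_lin k A; have [ar al] := lin_dact.
move=> sD; suff [] : rassoc s /\ forall d m, theta (dmul d s) m = theta d (dact s m) by [].
move: s sD; apply: double_gen_ind => [a s t [rs Es] [rt Et]|||x s xX [rs Es]].
- split=> [|d m]; first exact: rassoc_lin.
  by rewrite ml tl al tr Es Et.
- split=> [|d m]; first exact: rassoc0.
  by rewrite (lin0 (ml _)) (lin0 (tl _)) (lin0 (al _)) (lin0 (tr _)).
- split=> [|d m]; first exact: rassoc_dual.
  by rewrite (double_mul1 AX) dact1.
have Ex d m : theta (dmul d x) m = theta d (dact x m).
  move: x xX d m; apply: Dgen_ind => [a u v Eu Ev d m|d m|h d m|f d m].
  - by rewrite ml tl al tr Eu Ev.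
  - by rewrite (lin0 (ml _)) (lin0 (tl _)) (lin0 (al _)) (lin0 (tr _)).
  - exact: theta_grouplike.
  - exact: theta_dual.
split=> [|d m]; first by apply: rassoc_mul => //; exact: Dgen_rassoc.
(* That [x s] acts on [M] as [x] after [s] follows from the induction hypothesis at [d = x],
   projected by [evM]. *)
by rewrite rs Es Ex; congr (theta d _); rewrite [RHS]dact_theta Es -dact_theta.
Qed.

Local Notation Vm := (verma B rho).
Definition vgen (x : B) (m : M) : Vm :=
  proj (((x # 1%g : A) ⊗ dual_one A : D) ⊗ m).
Definition Theta : Vm -> tensor B M := ind_lift theta.

Lemma lin_Theta : lin Theta. Proof. exact: lin_ind_lift. Qed.

Lemma Theta_proj d m : Theta (proj (d ⊗ m)) = theta d m.
Proof.
rewrite /Theta ind_lift_proj ?tlift_tens //; try exact: lin_theta.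
by move=> a s w sS; exact: theta_Dge0.
Qed.

Lemma lin_proj : lin proj. Proof. exact: lin_ind_proj. Qed.

Lemma vgen_lin : bilin vgen.
Proof. by split=> ?; apply: (lin_comp lin_proj); lin_tac. Qed.

Lemma Theta_vgen x m : Theta (vgen x m) = x ⊗ m.
Proof. by rewrite /vgen Theta_proj thetaE restr_dual_one simpleDG_grp1. Qed.

(** Every [(x # h) ⊗ f] factors as [x # 1] times an element [(1 # h) ⊗ f] of [Dge0], which can be
    moved across the tensor sign. *)
Lemma vgen_Theta w : tlift vgen (Theta w) = w.
Proof.
have L : lin (fun t : tensor D M => tlift vgen (Theta (proj t))).
  exact: lin_comp (lin_tlift _ lin_id) (lin_comp lin_Theta lin_proj).
rewrite -[w](ind_projK (mul := dmul) (S := Dge0 B) (act := dact)).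
apply: (tens_ext L lin_proj) => d m.
rewrite Theta_proj.
apply: (D_ext (F := fun d => tlift vgen (theta d m)) (G := fun d => proj (d ⊗ m))) d => [||x h f].
- exact: lin_comp (lin_tlift _ lin_id) (lin_theta.2 m).
- by apply: (lin_comp lin_proj); lin_tac.
rewrite thetaE tlift_tens; last exact: vgen_lin.
have E : (x # h : A) ⊗ f = dmul ((x # 1%g : A) ⊗ dual_one A) ((1 # h : A) ⊗ f).
  by rewrite (double_mull AX) boson_ho_mulE bh_act1 mulr1 mul1g.
rewrite E ind_proj_balanced; [|exact: double_mul_lin|exact: lin_dact|exact: Dge0_mem].
by rewrite dactE bh_counit1 scale1r.
Qed.

Lemma verma_ext (Z : lmodType k) (F G : Vm -> Z) : lin F -> lin G ->
  (forall x m, F (vgen x m) = G (vgen x m)) -> F =1 G.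
Proof.
move=> FL GL FG w; rewrite -[w]vgen_Theta.
apply: (tens_ext (f := fun t => F (tlift vgen t)) (g := fun t => G (tlift vgen t))).
- exact: lin_comp FL (lin_tlift _ lin_id).
- exact: lin_comp GL (lin_tlift _ lin_id).
by move=> x m; rewrite tlift_tens //; exact: vgen_lin.
Qed.

Lemma verma_act_proj d d' m : verma_act d (proj (d' ⊗ m) : Vm) = proj (dmul d d' ⊗ m).
Proof.
rewrite /verma_act ind_actE //; [exact: double_mul_lin | exact: lin_dact |].
by move=> b s sS; exact: Dge0_rassoc.
Qed.

Lemma lin_verma_act d : lin (verma_act (rho := rho) (d : D)).
Proof. exact: lin_ind_act. Qed.

Lemma lin_verma_actl (w : Vm) : lin (fun d : D => verma_act d w).
Proof.
move=> a u v; move: w; apply: verma_ext => [||x m].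
- exact: lin_verma_act.
- by apply: lin_add; [apply: lin_scaler|]; exact: lin_verma_act.
rewrite !verma_act_proj -lin_proj; congr proj.
by rewrite (double_mul_lin _).2 (lin_tensl _ lin_id).
Qed.

Lemma verma_act_top d m : verma_act d (vgen 1 m) = proj (d ⊗ m).
Proof. by rewrite verma_act_proj [dmul _ _]double_mul1. Qed.

(** Projection to depth [i], that is, to degree [-i]. *)
Definition vcomp i : 'End(Vm) :=
  linfun (fun w => tlift (fun x m => vgen (comp i x) m) (Theta w)).

Lemma vcompE i x m : vcomp i (vgen x m) = vgen (comp i x) m.
Proof.
rewrite linfunE; last exact: lin_comp (lin_tlift _ lin_id) lin_Theta.
rewrite Theta_vgen tlift_tens //; split=> ?; first exact: vgen_lin.1.
by apply: (lin_comp (vgen_lin.2 _)); lin_tac.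
Qed.

Lemma vcomp_ortho i j w : vcomp i (vcomp j w) = if i == j then vcomp j w else 0.
Proof.
move: w; apply: verma_ext => [||x m]; [by lin_tac | by lin_tac |].
rewrite !vcompE na_comp_ortho; case: eqP => // _.
exact: (lin0 (vgen_lin.2 m)).
Qed.

Lemma vcomp_sum : exists b, forall w, \sum_(i < b) vcomp i w = w.
Proof.
have [b sumx] := na_comp_sum B; exists b.
apply: verma_ext => [||x m]; [by lin_tac | by [] |].
under eq_bigr do rewrite vcompE.
by rewrite -(lin_bigsum (vgen_lin.2 m)) sumx.
Qed.

Lemma vcomp_vgen i x m : x \in gr i -> vcomp i (vgen x m) = vgen x m.
Proof. by move=> xi; rewrite vcompE comp_id. Qed.

Lemma vcomp_ind (N : {vspace Vm}) i :
  (forall x m, x \in gr i -> vgen x m \in N) -> forall w, vcomp i w \in N.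
Proof.
move=> H w; rewrite -[w]vgen_Theta.
have L : lin (fun t => vcomp i (tlift vgen t)) by lin_tac.
move: (Theta w); apply: tens_ind => [a s t sN tN||x m].
- by rewrite L rpredD ?rpredZ.
- by rewrite (lin0 L) mem0v.
rewrite tlift_tens; last exact: vgen_lin.
by rewrite vcompE; apply: H; exact: gr_comp.
Qed.

Local Notation hom := (homop (fun d w => verma_act d w : Vm) vcomp).

Lemma proj_theta d m : proj (d ⊗ m) = tlift vgen (theta d m).
Proof. by rewrite -Theta_proj vgen_Theta. Qed.

(** The iterated coproduct of [x] splits its degree [j] as [i + i' + l]. The outer factors occur
    only inside [f], at arguments of degree [i + l], so [i + l = q] is forced; the middle factor has
    degree [j - q] and is multiplied by [y] of degree [p]. *)
Lemma homop_generator p q y h (f : hdual A) : y \in gr p ->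
  (forall i a, i != q -> a \in Agr B i -> f a = 0) -> hom p q ((y # h : A) ⊗ f).
Proof.
(* Both cases of [homop] become one membership, with [U] zero when the depth is too small. *)
move=> yp fq j w; pose U := if (q <= j)%N then limg (vcomp (p + (j - q))%N) else 0%VS.
suff : verma_act ((y # h : A) ⊗ f : D) (vcomp j w) \in U.
  rewrite /U; case: ifP => _; last by rewrite memv0 => /eqP.
  by case/memv_imgP=> v _ ->; rewrite vcomp_ortho eqxx.
have actL := lin_verma_act ((y # h : A) ⊗ f).
rewrite -(linfunE actL) memv_preim; apply: vcomp_ind => x m xj.
rewrite -memv_preim linfunE // verma_act_proj proj_theta.
pose L (t : D) := tlift vgen (theta t m).
have LL : lin L by exact: lin_comp (lin_tlift _ lin_id) (lin_theta.2 m).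
have LgL phi : lin (fun a : A => L (a ⊗ phi)) by apply: (lin_comp LL); lin_tac.
have LE x' h' phi : L ((x' # h' : A) ⊗ phi)
    = vgen x' (simpleDG_grp h' (simpleDG_fun (restr phi) m)).
  by rewrite /L thetaE tlift_tens //; exact: vgen_lin.
rewrite -/(L _) (double_mulE AX) (lin_sw3_comp _ _ LL).
apply: (Agr_sw3_mem (n := j)); last first.
- move=> i i' l a b c iil ai bi cl; rewrite (dual_1mul AX).
  have [il | il] := eqVneq (i + l)%N q; last first.
    suff -> : L (ho_mul (y # h : A) b ⊗ conjd f a (ho_anti c)) = 0 by rewrite mem0v.
    (* Only the restriction to [kG] acts on [M], and group elements have degree 0, so the argument
       of [f] has degree [i + l]. *)
    have r0 : restr (conjd f a (ho_anti c)) = 0.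
      apply/lfunP; apply: grpalg_ext => [||z]; [by lin_tac | by lin_tac |].
      rewrite zero_lfunE restrE (conjdE AX); apply: (fq (i + (0 + l))%N).
        by rewrite add0n.
      apply/Agr_mul => //; apply: Agr_mul; last exact: Agr_anti.
      by apply: mem_Agr; exact: one_gr0.
    apply: (boson_ext (f := fun a' => L (a' ⊗ _)) (h := fun=> 0)) => [||x' h'].
    + exact: LgL.
    + exact: lin_cst0.
    by rewrite LE r0 (lin0 (lin_simpleDG_funl m lin_id)) (lin0 (lin_simpleDG_grp _)) (lin0 (vgen_lin.1 _)).
  have qj : (q <= j)%N by rewrite -il -iil -addnA leq_add2l leq_addl.
  have ji : (j - q)%N = i' by rewrite -il -iil addnAC addKn.
  rewrite /U qj ji; have : ho_mul (y # h : A) b \in Agr B (p + i').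
    by apply: Agr_mul => //; exact: mem_Agr.
  apply: (Agr_lin_mem (LgL _)) => x' h' xp.
  by rewrite LE -(vcomp_vgen _ xp) memv_img ?memvf.
- exact: mem_Agr.
split=> ? ?; apply: (lin_comp LL).
- apply/lin_tensr/(lin_dmulr AX)/(lin_conjd3 AX)/(lin_hanti AX)/lin_id.
- apply/lin_tensl/(lin_hmulr AX)/lin_id.
- apply/lin_tensr/(lin_dmulr AX)/(lin_conjd2 AX)/lin_id.
Qed.

Lemma homop_left p y h : y \in gr p -> hom p 0 ((y # h : A) ⊗ dual_one A).
Proof.
move=> yp; apply: homop_generator => // i a i0 ai; rewrite (dual_oneE AX).
apply/eqP; rewrite -memv0; move: a ai; apply: Agr_lin_mem => [|x h' xi].
  exact: hx_counitL AX.
by rewrite memv0 boson_counitE (na_gr_counit xi) // lt0n.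
Qed.

Lemma homop_fun f : hom 0 0 (ho_one A ⊗ fun_of_kG B f).
Proof.
apply: homop_generator => [|i a i0 ai]; first exact: one_gr0.
apply/eqP; rewrite -memv0; move: a ai; apply: Agr_lin_mem => [|x h' xi].
  by lin_tac.
by rewrite memv0 fun_of_kGE (na_gr_counit xi) ?mul0r // lt0n.
Qed.

(** The double is spanned by the [(y # h) ⊗ f] with [y] homogeneous and [f] supported in one degree:
    cut both into components. *)
Lemma homop_stable_verma (N : {vspace Vm}) :
  (forall p q d, hom p q d -> forall w, w \in N -> verma_act d w \in N) ->
  stable (fun d w => verma_act d w : Vm) N.
Proof.
move=> homN d w wN; have aL := lin_verma_actl w.
have [b sumx] := na_comp_sum B.
move: d; apply: tens_ind => [a s t sN tN||a f].
- by rewrite aL rpredD ?rpredZ.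
- by rewrite (lin0 aL) mem0v.
move: a; apply: boson_ind => [a s t sN tN||y h].
- by rewrite (lin_tensl _ lin_id) aL rpredD ?rpredZ.
- by rewrite (lin0 (lin_tensl _ lin_id)) (lin0 aL) mem0v.
pose cA q : 'End(A) := linfun (fun a : A => blift (fun x g => comp q x # g) a).
have cAE q x h' : cA q (x # h') = comp q x # h'.
  rewrite linfunE; last exact: lin_blift lin_id.
  by rewrite bliftE // => ?; lin_tac.
have -> : f = \sum_(q < b) (f \o cA q)%VF.
  apply: hdual_ext => x h'; rewrite sum_lfunE -[in LHS](sumx x).
  rewrite (lin_bigsum (f := fun x => f (x # h'))); last by lin_tac.
  by apply: eq_bigr => q _; rewrite comp_lfunE cAE.
rewrite -[y]sumx (lin_bigsum (f := fun x => tens (x # h) _)); last by lin_tac.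
rewrite (lin_bigsum aL) memv_suml // => p _.
rewrite (lin_bigsum (lin_tensr _ lin_id)) (lin_bigsum aL) memv_suml // => q _.
apply: (homN p q) => //; apply: homop_generator => [|i a iq]; first exact: gr_comp.
move=> ai; apply/eqP; rewrite -memv0; move: a ai; apply: Agr_lin_mem => [|x h' xi].
  by lin_tac.
by rewrite memv0 comp_lfunE cAE (comp_neq xi) 1?eq_sym // (lin0 (lin_tensl _ lin_id)) linear0.
Qed.

Lemma vcomp0E w : vcomp 0 w = vgen 1 (evM (Theta w)).
Proof.
move: w; apply: verma_ext => [||x m]; first by lin_tac.
  exact: lin_comp (vgen_lin.1 _) (lin_comp lin_evM lin_Theta).
rewrite vcompE comp0 Theta_vgen evME (linZ (vgen_lin.1 _)).
exact: (linZ (vgen_lin.2 m)).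
Qed.

Hypothesis irr : mx_irreducible rho.

Lemma top_generates_verma (N : {vspace Vm}) :
  stable (fun d w => verma_act d w : Vm) N -> ~~ (N <= lker (vcomp 0))%VS -> N = fullv.
Proof.
move=> sN /subvPn[y0 y0N]; rewrite memv_ker => y00.
have [b sumw] := vcomp_sum.
have vL := vgen_lin.1 1.
(* The top components of elements of [N], seen inside [M]. *)
pose P := (linfun (vgen 1) @^-1: (vcomp 0 @: N))%VS.
have memP m : (m \in P) = (vgen 1 m \in (vcomp 0 @: N)%VS).
  by rewrite -memv_preim linfunE.
(* An operator of degree 0 commutes with [vcomp 0], so it sends top components of [N] to top
   components of [N]. *)
have stabP d m m' : hom 0 0 d -> verma_act d (vgen 1 m) = vgen 1 m' -> m \in P -> m' \in P.
  move=> hd E; rewrite !memP -E => /memv_imgP[y yN ->].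
  rewrite -(homop_cp _ vcomp_ortho sumw (p := 0) (q := 0)) ?memv_img //; last first.
    exact: lin_verma_act.
  exact: sN.
have Pfull : P = fullv.
  apply: (simpleDG_simple irr) => [h m|f m|].
  - apply: (stabP ((1 # h : A) ⊗ dual_one A)); first exact/homop_left/one_gr0.
    rewrite verma_act_top proj_theta thetaE restr_dual_one tlift_tens //.
    exact: vgen_lin.
  - apply: (stabP (ho_one A ⊗ fun_of_kG B f)); first exact: homop_fun.
    rewrite verma_act_top proj_theta [theta _ _]thetaE simpleDG_grp1.
    rewrite tlift_tens; last exact: vgen_lin.
    suff -> : restr (fun_of_kG B f) = f by [].
    apply/lfunP; apply: grpalg_ext => [||z]; [by lin_tac | by lin_tac |].
    by rewrite restrE fun_of_kGE bh_counit1 mul1r.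
  apply: contraNneq y00 => P0; rewrite vcomp0E.
  have : evM (Theta y0) \in P by rewrite memP -vcomp0E memv_img.
  by rewrite P0 memv0 => /eqP ->; rewrite (lin0 vL).
(* Induction on the distance from the bottom: depths from [b] on vanish, and step [j] reaches depth
   [b - j]. *)
have low j : forall i x m, (b <= i + j)%N -> x \in gr i -> vgen x m \in N.
  elim: j => [|j IH] i x m bij xi.
    rewrite -(vcomp_vgen m xi) (cp_big vcomp_ortho sumw) ?mem0v //.
    by rewrite addn0 in bij.
  have /memv_imgP[y yN yE] : vgen 1 m \in (vcomp 0 @: N)%VS by rewrite -memP Pfull memvf.
  pose d : D := (x # 1%g : A) ⊗ dual_one A.
  have dy : verma_act d y \in N by exact: sN.
  have aL := lin_verma_act d.
  have d1 : verma_act d (vgen 1 m) = vgen x m by rewrite verma_act_top.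
  case: b sumw bij IH => [|b'] sumw bij IH.
    by rewrite -[vgen x m]sumw big_ord0 mem0v.
  move: dy; rewrite -{1}(sumw y) big_ord_recl (linD aL) -yE d1 (lin_bigsum aL).
  suff lowN : \sum_(l < b') verma_act d (vcomp (lift ord0 l) y) \in N.
    by move=> dy; rewrite -[vgen x m](addrK (\sum_(l < b') verma_act d (vcomp (lift ord0 l) y))) rpredB.
  rewrite memv_suml // => l _.
  (* A component of [y] in depth [l + 1] is pushed by [x] to depth [i + l + 1], strictly below [i],
     where the induction hypothesis applies. *)
  rewrite (homop_left 1%g xi) subn0; apply: vcomp_ind => x' m'.
  by apply: IH; rewrite lift0 addnS addSn -addnS (leq_trans bij) // addnAC leq_addr.
apply/vspaceP => w; rewrite memvf -[w]sumw memv_suml // => i _.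
by apply: vcomp_ind => x m; apply: (low b); rewrite leq_addl.
Qed.

Lemma vcomp_neq0 : exists w, vcomp 0 w != 0.
Proof.
have [m m0] := simpleDG_nontrivial irr; exists (vgen 1 m).
rewrite vcomp0E Theta_vgen evME bh_counit1 scale1r.
apply: contraNneq m0 => v0; have := Theta_vgen 1 m; rewrite v0 (lin0 lin_Theta).
by move/(congr1 evM); rewrite (lin0 lin_evM) evME bh_counit1 scale1r => <-.
Qed.

Lemma vgen_verma_gr i x m : x \in gr i -> vgen x m \in verma_gr B rho (- i%:Z).
Proof.
move=> xi; rewrite /verma_gr Num.Theory.oppr_le0 abszN absz_nat /=.
rewrite (coord_vbasis xi) (lin_bigsum (vgen_lin.2 m)) memv_suml // => j _.
rewrite (linZ (vgen_lin.2 m)) memvZ //.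
rewrite [m]coord_vbasis_sum (lin_bigsum (vgen_lin.1 _)) memv_suml // => l _.
rewrite (linZ (vgen_lin.1 _)) memvZ //; apply/memv_span/allpairsP.
exists ((vbasis (gr i))`_j, (vbasis {:M})`_l).
by rewrite !mem_nth ?size_tuple.
Qed.

End VermaTheory.

Theorem theorem1 (k : closedFieldType) (hchar : [pchar k] =i pred0)
    (gT : finGroupType) (hG : ~~ abelian [set: gT])
    (V : vectType k) (ydV : ydStruct gT V) (B : nicholsAlgebra ydV)
    (g : gT) (n : nat) (rho : mx_representation k 'C[g]%g n)
    (hrho : mx_irreducible rho) :
  exists N : {vspace verma B rho},
    [/\ maximal_submodule N,
        forall N' : {vspace verma B rho}, maximal_submodule N' -> N' = N
      & homogeneous N].
Proof.
have [b sumw] := vcomp_sum B rho.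
have [N [maxN uniqN grN]] := graded_unique_maximal (@lin_verma_act _ _ _ _ B g n rho)
  (@vcomp_ortho _ _ _ _ B g n rho) sumw (@homop_stable_verma _ _ _ _ B g n rho)
  (top_generates_verma hrho) (vcomp_neq0 B hrho).
exists N; split=> // w wN.
(* Depth [i] is degree [-i], and the depths below [b] exhaust the module. *)
exists [seq - i%:Z | i <- index_iota 0 b]; rewrite big_map big_mkord -[w]sumw.
apply: memv_sumr => i _; rewrite memv_cap grN //=.
by apply: vcomp_ind => x m; exact: vgen_verma_gr.
Qed.
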